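(* Let $\lambda\in\mathbb{R}_+=[0,\infty)$, $b>0$, and let $(\mathrm{m}^b_{\lambda,t})_{t\ge0}$ be the process $(\mathrm{m}_{\lambda,t})_{t\ge0}$ (defined in the context) started from $\mathrm{m}^b_{\lambda,0}=\delta_b$. Then its $R$-transform and $S$-transform are given, for $t\ge0$, by $$R_{\mathrm{m}^b_{\lambda,t}}(z)=\frac{z\{(\lambda t+b)-\lambda t^2z\}}{(1-tz)^2},$$ $$S_{\mathrm{m}^b_{\lambda,t}}(z)=\frac{1}{t(\lambda+z)}\left[1+\frac{\lambda}{2z}+\frac{b}{2tz}-\frac{1}{2z}\Big(\lambda+\frac bt\Big)\sqrt{1+\frac{4b/t}{(\lambda+b/t)^2}\,z}\;\right].$$
   Context: $\mathcal{P}^0(\mathbb{R}_+)$ is the set of Borel probability measures on $\mathbb{R}_+$ with bounded support, with the weak topology. The Cauchy transform is $G_\mu(z)=\int\frac{\mu(dx)}{z-x}$. The process $(\mathrm{m}_{\lambda,t})_{t\ge0}$ is a continuous $\mathcal{P}^0(\mathbb{R}_+)$-valued process whose Cauchy transforms solve, for $t\ge0$ and $z\in\mathbb{C}^+=\{\operatorname{Im}z>0\}$, $$\frac{\partial G_{\mathrm{m}_{\lambda,t}}(z)}{\partial t}+\{2zG_{\mathrm{m}_{\lambda,t}}(z)-(1-\lambda)\}\frac{\partial G_{\mathrm{m}_{\lambda,t}}(z)}{\partial z}+G_{\mathrm{m}_{\lambda,t}}(z)^2=0$$ with initial datum $G_{\mathrm{m}_{\lambda,0}}$. The $R$-transform is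 $R_\mu(z)=zG_\mu^{\langle-1\rangle}(z)-1$, where $G_\mu^{\langle-1\rangle}$ is the compositional inverse of $G_\mu$ (defined near $z=0$, inverting $G_\mu$ near $\infty$). $S$-transform: let $\Psi_\mu(z)=\int\frac{xz}{1-xz}\mu(dx)$. For $\mu\in\mathcal{P}^0(\mathbb{R}_+)$ with $\mu(\{0\})<1$, $\Psi_\mu$ has a unique inverse $\chi_\mu$ on the left half-plane $\sqrt{-1}\,\mathbb{C}^+$, and $S_\mu(z)=\frac{1+z}{z}\chi_\mu(z)$. Formulas are identities of analytic functions near $z=0$ (on the domain of the $S$-transform for the second one); the square root is the branch equal to $1$ at $z=0$. At $t=0$ the $S$-transform formula is understood as the limit $t\downarrow0$ (which gives $S_{\delta_b}(z)=1/b$). *)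

(* Defs.v *)
From HB Require Import structures.
From mathcomp Require Import all_boot all_order all_algebra.
From mathcomp Require Import all_classical all_reals all_analysis.
From mathcomp Require Import complex.

Set Implicit Arguments.
Unset Strict Implicit.
Unset Printing Implicit Defensive.

Import Order.TTheory GRing.Theory Num.Theory.
Import numFieldNormedType.Exports.

Local Open Scope classical_set_scope.
Local Open Scope ring_scope.
Local Open Scope complex_scope.


(* Measures on R_+ are Borel measures on R giving full mass to [0, +oo[.      *)
Definition P0 (R : realType) (mu : probability (measurableTypeR R) R) : Prop :=
  exists M : R, mu `[0, M]%classic = 1%E.

Definition Cintegral (R : realType) (mu : probability (measurableTypeR R) R)
    (f : R -> R[i]) : R[i] :=
  (\int[mu]_(x in `[0, +oo[) complex.Re (f x))%R +i*
  (\int[mu]_(x in `[0, +oo[) complex.Im (f x))%R.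

Definition cauchy_transform (R : realType)
    (mu : probability (measurableTypeR R) R) (z : R[i]) : R[i] :=
  Cintegral mu (fun x => (z - x%:C)^-1).

Definition weakly_continuous (R : realType)
    (m : R -> probability (measurableTypeR R) R) : Prop :=
  forall f : R -> R,
    {within `[0, +oo[, continuous f} ->
    [bounded f x | x in `[0, +oo[] ->
    {within `[0, +oo[, continuous
      (fun t : R => (\int[m t]_(x in `[0, +oo[) f x)%R)}.

(* Only the alias [R[i]^o] (not [R[i]]) carries the topology and normed-module *)
(* structure of the complex field over itself; with it, [derive1] below is   *)
(* the complex derivative.                                                   *)

(* Derivative of a complex-valued function of a real variable t >= 0;        *)
(* it is one-sided at t = 0.                                                 *)
Definition is_time_derivative (R : realType) (g : R -> R[i]) (t : R)
    (l : R[i]) : Prop :=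
  (fun s : R => ((s - t)^-1)%:C * (g s - g t) : R[i]^o)
    @ within `[0, +oo[ t^' --> (l : R[i]^o).

Definition cauchy_pde (R : realType) (lambda : R)
    (m : R -> probability (measurableTypeR R) R) : Prop :=
  forall (t : R) (z : R[i]), 0 <= t -> 0 < complex.Im z ->
    let G (s : R) (w : R[i]) : R[i] := cauchy_transform (m s) w in
    exists dtG : R[i],
      is_time_derivative (fun s => G s z) t dtG /\
      dtG + (2 * z * G t z - (1 - lambda)%:C)
              * (derive1 (G t : R[i]^o -> R[i]^o) z : R[i])
          + G t z ^+ 2 = 0.

Definition is_m_process (R : realType) (lambda : R)
    (m : R -> probability (measurableTypeR R) R) : Prop :=
  [/\ forall t : R, 0 <= t -> P0 (m t),
      weakly_continuous m &
      cauchy_pde lambda m].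

(* [K] inverts [G_mu] between a neighbourhood of infinity and a punctured    *)
(* neighbourhood of 0; this determines the germ of [K] at 0.                 *)
Definition cauchy_inverse_spec (R : realType)
    (mu : probability (measurableTypeR R) R) (K : R[i] -> R[i]) : Prop :=
  (exists r : R, forall z : R[i], r%:C < `|z| -> K (cauchy_transform mu z) = z)
  /\ (\forall w \near (0 : R[i]^o)^', cauchy_transform mu (K w) = w).

Definition cauchy_inverse (R : realType)
    (mu : probability (measurableTypeR R) R) : R[i] -> R[i] :=
  xget (fun=> 0) (cauchy_inverse_spec mu).

(* R has a removable singularity at 0, where this expression is not meaningful. *)
Definition R_transform (R : realType)
    (mu : probability (measurableTypeR R) R) (z : R[i]) : R[i] :=
  z * cauchy_inverse mu z - 1.

Definition Psi (R : realType) (mu : probability (measurableTypeR R) R)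
    (z : R[i]) : R[i] :=
  Cintegral mu (fun x => x%:C * z / (1 - x%:C * z)).

(* i C^+ = {z | Re z < 0}.                                                   *)
Definition left_half_plane (R : realType) : set R[i] :=
  [set 'i%C * w | w in [set w : R[i] | 0 < complex.Im w]].

Definition S_domain (R : realType)
    (mu : probability (measurableTypeR R) R) : set R[i] :=
  Psi mu @` @left_half_plane R.

(* On [S_domain mu] this is the inverse of [Psi mu] on the left half-plane,   *)
(* which is injective there when mu {0} < 1.                                 *)
Definition chi (R : realType) (mu : probability (measurableTypeR R) R)
    (z : R[i]) : R[i] :=
  xget 0 [set u | @left_half_plane R u /\ Psi mu u = z].

Definition S_transform (R : realType)
    (mu : probability (measurableTypeR R) R) (z : R[i]) : R[i] :=
  (1 + z) / z * chi mu z.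

Definition R_formula (R : realType) (lambda b t : R) (z : R[i]) : R[i] :=
  z * ((lambda * t + b)%:C - (lambda * t ^+ 2)%:C * z) / (1 - t%:C * z) ^+ 2.

(* [sqrtc] is the principal square root (nonnegative real part, cut along     *)
(* the negative reals), unlike [Num.sqrtC], whose cut is along the positive   *)
(* reals and which is thus discontinuous at 1.                                *)
Definition S_formula (R : realType) (lambda b t : R) (z : R[i]) : R[i] :=
  (t%:C * (lambda%:C + z))^-1 *
  (1 + lambda%:C / (2 * z) + b%:C / (2 * t%:C * z)
   - (2 * z)^-1 * (lambda + b / t)%:C
     * sqrtc (1 + (4 * (b / t) / (lambda + b / t) ^+ 2)%:C * z)).

(* Main.v *)
Require Import Defs.
From mathcomp Require Import all_boot all_order all_algebra.
From mathcomp Require Import all_classical all_reals all_analysis.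
From mathcomp Require Import complex.
From mathcomp Require Import measurable_realfun ring lra.
Import Order.TTheory GRing.Theory Num.Theory.
Import numFieldNormedType.Exports.
Import Normc.
Local Open Scope classical_set_scope.
Local Open Scope ring_scope.
Local Open Scope complex_scope.

(** Along the characteristic curve of the equation ending at a point [v] of the upper
half-plane at time [t], the Cauchy transform satisfies [dG/ds = - G^2], so the curve
is an explicit function of [s], [v] and [w = G_t(v)]. No existence theorem for the
characteristics is needed: inserting the explicit curve into [G_s], the defect solves a
linear homogeneous equation and vanishes at [s = t], hence vanishes as long as the curve
stays in the upper half-plane. It does, because
[Im (z G(z)) = - Im z * \int x / |z - x|^2 <= 0] makes its height increase
backwards in time. Evaluating at [s = 0], where [G_0(z) = 1 / (z - b)], yields an algebraic
relation between [v] and [G_t(v)], which extends off the support by conjugation and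
continuity. Solving it for [v] gives an explicit inverse of [G_t], whose injectivity near
[0] gives the R-transform. For the S-transform, put [z = v G_t(v) - 1] with [Re v < 0]: the
relation becomes quadratic in [w = G_t(v)], and [S = w / z]. The root is the one given by
the principal square root because the relevant square root of the discriminant,
[lambda t + b (1 + t w) / (1 - t w)], has positive real part: it does near infinity, and
its real part never vanishes on the left half-plane. *)

Set Implicit Arguments.
Unset Strict Implicit.
Unset Printing Implicit Defensive.

Local Notation re := (@complex.Re _).
Local Notation im := (@complex.Im _).

(** * Modulus, real part and imaginary part of complex numbers *)

Section complex_facts.
Variable R : realType.
Implicit Types (x y z : R[i]) (a b : R).

Lemma normc_normr z : `|z| = (normc z)%:C.
Proof. by case: z. Qed.

Lemma reD x y : re (x + y) = re x + re y.
Proof. by case: x; case: y. Qed.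
Lemma imD x y : im (x + y) = im x + im y.
Proof. by case: x; case: y. Qed.
Lemma reN x : re (- x) = - re x.
Proof. by case: x. Qed.
Lemma imN x : im (- x) = - im x.
Proof. by case: x. Qed.
Lemma reM x y : re (x * y) =
  re x * re y - im x * im y.
Proof. by case: x; case: y. Qed.
Lemma imM x y : im (x * y) =
  re x * im y + im x * re y.
Proof. by case: x => ? ?; case: y => ? ? /=. Qed.
Lemma reV x : re x^-1 = re x / (normc x ^+ 2).
Proof. by case: x => a b /=; rewrite sqr_sqrtr// addr_ge0 ?sqr_ge0. Qed.
Lemma imV x : im x^-1 = - im x / (normc x ^+ 2).
Proof. by case: x => a b /=; rewrite sqr_sqrtr ?mulNr// addr_ge0 ?sqr_ge0. Qed.

Lemma normc_ge0 z : 0 <= normc z. Proof. by case: z => a b; exact: sqrtr_ge0. Qed.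

Lemma sqr_normcE z : normc z ^+ 2 = re z ^+ 2 + im z ^+ 2.
Proof. by case: z => a b /=; rewrite sqr_sqrtr// addr_ge0 ?sqr_ge0. Qed.

Lemma normc_Re z : `|re z| <= normc z.
Proof. by case: z => a b /=; rewrite -sqrtr_sqr ler_wsqrtr // lerDl sqr_ge0. Qed.
Lemma normc_Im z : `|im z| <= normc z.
Proof. by case: z => a b /=; rewrite -sqrtr_sqr ler_wsqrtr // lerDr sqr_ge0. Qed.


Lemma normc_le_ReIm z : normc z <= `|re z| + `|im z|.
Proof.
rewrite {1}[z]complexE; apply: (le_trans (le_normcD _ _)).
have E a : normc a%:C = `|a| by rewrite /= expr0n/= addr0 sqrtr_sqr.
by rewrite normcM !E /= expr0n expr1n/= add0r sqrtr1 mul1r.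
Qed.

Lemma normcR a : normc a%:C = `|a|.
Proof. by rewrite /= expr0n/= addr0 sqrtr_sqr. Qed.

Lemma normc_eq0 z : (normc z == 0) = (z == 0).
Proof. by apply/eqP/eqP => [/eq0_normc|->]//; rewrite normc0. Qed.

Lemma normc_gt0 z : (0 < normc z) = (z != 0).
Proof. by rewrite lt0r normc_eq0 normc_ge0 andbT. Qed.

Lemma normcX z n : normc (z ^+ n) = normc z ^+ n.
Proof. by elim: n => [|n IH]; rewrite ?expr0 ?normc1// !exprS normcM IH. Qed.

Lemma normc_distrC x y : normc (x - y) = normc (y - x).
Proof. by rewrite -normcN opprB. Qed.

Lemma ler_normcB x y : normc x - normc y <= normc (x - y).
Proof. by rewrite lerBlDr (le_trans _ (le_normcD _ _))// subrK. Qed.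

Lemma ler_normcBD x y : normc (x - y) <= normc x + normc y.
Proof. by rewrite (le_trans (le_normcD _ _))// normcN. Qed.

Lemma eq_ReIm x y : re x = re y -> im x = im y -> x = y.
Proof. by case: x => a b; case: y => c d /= -> ->. Qed.

End complex_facts.

(** Inversion is continuous off [0], and on the singleton [[set 0]] every function is measurable. *)
Lemma measurable_inv (R : realType) : measurable_fun [set: R] (fun x : R => x^-1).
Proof.
have m0 : measurable [set 0 : R] by [].
rewrite -(setvU [set 0 : R]); apply/measurable_funU => //; first exact: measurableC.
split; last exact: measurable_fun_set1.
apply: open_continuous_measurable_fun.
  by rewrite openC; apply: closed_eq.
by move=> x; rewrite inE => /= /eqP x0; exact: inv_continuous.
Qed.

(** * Complex-valued integrals *)

Section complex_integral.
Variables (d : measure_display) (T : measurableType d) (R : realType).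
Variable mu : probability T R.
Implicit Types (D : set T) (f g : T -> R[i]) (c : R[i]).

(** Against a probability measure this suffices for both parts to be integrable, and the class is
    stable under sums and products. *)
Definition bmeas D f :=
  [/\ measurable_fun D (re \o f), measurable_fun D (im \o f) &
      exists C, forall x, D x -> normc (f x) <= C].

(** [Cintegral] with the domain as a parameter, so that an integral can be moved to a smaller set of
    full mass (a bounded interval, a point), where more resolvents are bounded. *)
Definition Cint D f : R[i] :=
  (\int[mu]_(x in D) re (f x))%R +i* (\int[mu]_(x in D) im (f x))%R.

Lemma bmeas_cst D c : bmeas D (cst c).
Proof. by split; [exact: measurable_cst|exact: measurable_cst|exists (normc c)]. Qed.

Lemma bmeasD D f g : bmeas D f -> bmeas D g -> bmeas D (fun x => f x + g x).
Proof.
move=> [rf imf [C fC]] [rg img [C' gC']]; split.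
- by rewrite (_ : _ \o _ = (re \o f) \+ (re \o g));
    [exact: measurable_funD|apply/funext => x/=; rewrite reD].
- by rewrite (_ : _ \o _ = (im \o f) \+ (im \o g));
    [exact: measurable_funD|apply/funext => x/=; rewrite imD].
- exists (C + C') => x Dx; apply: (le_trans (le_normcD _ _)).
  by apply: lerD; [exact: fC|exact: gC'].
Qed.

Lemma bmeasM D f g : bmeas D f -> bmeas D g -> bmeas D (fun x => f x * g x).
Proof.
move=> [rf imf [C fC]] [rg img [C' gC']]; split.
- rewrite (_ : _ \o _ = ((re \o f) \* (re \o g)) \-
    ((im \o f) \* (im \o g))).
    by apply: measurable_funB; exact: measurable_funM.
  by apply/funext => x/=; rewrite reM.
- rewrite (_ : _ \o _ = ((re \o f) \* (im \o g)) \+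
    ((im \o f) \* (re \o g))).
    by apply: measurable_funD; exact: measurable_funM.
  by apply/funext => x/=; rewrite imM.
- exists (C * C') => x Dx; rewrite normcM.
  by apply: ler_pM; rewrite ?normc_ge0//; [exact: fC|exact: gC'].
Qed.

Lemma bmeas_Re_integrable D f : measurable D -> bmeas D f ->
  mu.-integrable D (EFin \o (re \o f)).
Proof.
move=> mD [rf imf [C fC]]; apply: measurable_bounded_integrable => //.
  by rewrite (le_lt_trans (probability_le1 _ _))// ltry.
exists C; split; first exact: num_real.
move=> M CM x Dx /=; apply: (le_trans (normc_Re _)).
exact: le_trans (fC _ Dx) (ltW _).
Qed.

Lemma bmeas_Im_integrable D f : measurable D -> bmeas D f ->
  mu.-integrable D (EFin \o (im \o f)).
Proof.
move=> mD [rf imf [C fC]]; apply: measurable_bounded_integrable => //.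
  by rewrite (le_lt_trans (probability_le1 _ _))// ltry.
exists C; split; first exact: num_real.
move=> M CM x Dx /=; apply: (le_trans (normc_Im _)).
exact: le_trans (fC _ Dx) (ltW _).
Qed.

Lemma CintD D f g : measurable D -> bmeas D f -> bmeas D g ->
  Cint D (fun x => f x + g x) = Cint D f + Cint D g.
Proof.
move=> mD bf bg; rewrite /Cint.
under eq_Rintegral do rewrite reD.
rewrite RintegralD//; [|exact: bmeas_Re_integrable|exact: bmeas_Re_integrable].
under [in X in _ +i* X = _]eq_Rintegral do rewrite imD.
by rewrite RintegralD//; [exact: bmeas_Im_integrable|exact: bmeas_Im_integrable].
Qed.

Lemma integrableZlR D (f : T -> R) k : measurable D ->
  mu.-integrable D (EFin \o f) -> mu.-integrable D (EFin \o (fun x => k * f x)).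
Proof. by move=> mD fi; exact: (integrableZl mD k fi). Qed.

Lemma CintZ D f c : measurable D -> bmeas D f ->
  Cint D (fun x => c * f x) = c * Cint D f.
Proof.
move=> mD bf; have iR := bmeas_Re_integrable mD bf; have iI := bmeas_Im_integrable mD bf.
apply: eq_ReIm.
  rewrite reM /=; under eq_Rintegral do rewrite reM.
  by rewrite RintegralB ?RintegralZl//; exact: integrableZlR.
rewrite imM /=; under eq_Rintegral do rewrite imM.
by rewrite RintegralD ?RintegralZl//; exact: integrableZlR.
Qed.

Lemma eq_Cint D f g : (forall x, D x -> f x = g x) -> Cint D f = Cint D g.
Proof.
by move=> fg; congr (_ +i* _); apply: eq_Rintegral => x /set_mem Dx; rewrite fg.
Qed.

Lemma Rintegral_probability_cst D (r : R) : measurable D -> mu D = 1%E ->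
  \int[mu]_(x in D) r = r.
Proof.
move=> mD D1; rewrite Rintegral_cst//.
by rewrite (_ : fine _ = fine (mu D))// D1 mulr1.
Qed.

Lemma Cint_cst D c : measurable D -> mu D = 1%E -> Cint D (fun=> c) = c.
Proof.
by move=> mD D1; rewrite /Cint !Rintegral_probability_cst//; case: c.
Qed.

Lemma CintB D f g : measurable D -> bmeas D f -> bmeas D g ->
  Cint D (fun x => f x - g x) = Cint D f - Cint D g.
Proof.
move=> mD bf bg; rewrite -[X in _ + X]mulN1r -CintZ// -CintD//; last first.
  by apply: bmeasM => //; exact: bmeas_cst.
by apply: eq_Cint => x _; rewrite mulN1r.
Qed.

Lemma le_Rint_bound D (f : T -> R) C : measurable D -> mu D = 1%E ->
  mu.-integrable D (EFin \o f) -> (forall x, D x -> `|f x| <= C) ->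
  `|\int[mu]_(x in D) f x| <= C.
Proof.
move=> mD D1 fi fC; apply: (le_trans (le_normr_Rintegral mD fi)).
have -> : C = \int[mu]_(x in D) C by rewrite Rintegral_probability_cst.
apply: le_Rintegral => //.
  by rewrite (_ : _ \o _ = abse \o (EFin \o f))//; exact: integrable_abse.
apply: (@measurable_bounded_integrable _ _ _ mu (cst C)) => //.
  by rewrite (_ : _ D = mu D)// D1 ltry.
by exists `|C|; split; [exact: num_real|move=> M CM x _ /=; exact: ltW].
Qed.

(** The factor [2] comes from bounding the real and imaginary parts separately; every later bound
    inherits it. *)
Lemma normc_Cint_le D f C : measurable D -> mu D = 1%E -> bmeas D f ->
  (forall x, D x -> normc (f x) <= C) -> normc (Cint D f) <= 2 * C.
Proof.
move=> mD D1 bf fC; apply: (le_trans (normc_le_ReIm _)).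
have -> : 2 * C = C + C by ring.
apply: lerD; apply: le_Rint_bound => //.
- exact: bmeas_Re_integrable.
- by move=> x Dx; apply: le_trans (normc_Re _) _; exact: fC.
- exact: bmeas_Im_integrable.
- by move=> x Dx; apply: le_trans (normc_Im _) _; exact: fC.
Qed.

End complex_integral.

(** [E] minus [D] is null, so [f] and its restriction to [D] agree almost everywhere. On [E] only
    measurability is asked, since a resolvent may be unbounded there. *)
Lemma Cint_full_subset d (T : measurableType d) (R : realType)
    (mu : probability T R) (D E : set T) (f : T -> R[i]) :
  measurable D -> measurable E -> D `<=` E -> mu D = 1%E ->
  measurable_fun E (re \o f) -> measurable_fun E (im \o f) ->
  Cint mu E f = Cint mu D f.
Proof.
move=> mD mE DE D1.
have key (g : T -> R) : measurable_fun E g ->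
    \int[mu]_(x in E) g x = \int[mu]_(x in D) g x.
  move=> mg; rewrite /Rintegral; congr fine.
  rewrite -[in RHS](setIidr DE) integral_mkcondr; apply: ae_eq_integral => //.
  - exact/measurable_EFinP.
  - have -> : (fun x => (g x)%:E) \_ D = EFin \o (g \_ D).
      by apply/funext => x /=; rewrite !patchE; case: ifP.
    apply/measurable_EFinP.
    apply: measurable_funTS; apply/(measurable_restrictT _ mD).
    exact: (measurable_funS mE DE mg).
  - exists (~` D); split; first exact: measurableC.
      rewrite (_ : _ (~` D) = mu (~` D))// probability_setC// D1.
      by rewrite subee.
    move=> x /= + Dx; apply => Ex.
    by rewrite patchE mem_set.
by move=> mr mi; rewrite /Cint !key.
Qed.

(** * The resolvent and the Cauchy transform *)

Section resolvent.
Variables (R : realType).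
Implicit Types (D : set R) (z : R[i]) (e x : R).

Definition resolvent z : measurableTypeR R -> R[i] := fun x => (z - x%:C)^-1.

Lemma measurable_resolvent z : measurable_fun setT (re \o resolvent z) /\
  measurable_fun setT (im \o resolvent z).
Proof.
pose n (x : measurableTypeR R) := (re z - x) ^+ 2 + im z ^+ 2.
have mB : measurable_fun setT (fun x : measurableTypeR R => re z - x).
  by apply: measurable_funB => //; exact: measurable_cst.
have mn : measurable_fun setT n.
  by apply: measurable_funD => //; exact: measurable_funX.
have mV : measurable_fun setT (fun x => (n x)^-1).
  exact: (measurableT_comp (@measurable_inv R) mn).
split.
  rewrite (_ : _ \o _ = (fun x => re z - x) \* (fun x => (n x)^-1)).
    exact: measurable_funM.
  apply/funext => x /=; rewrite /resolvent reV sqr_normcE reD imD reN imN/=.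
  by rewrite oppr0 addr0.
rewrite (_ : _ \o _ = (cst (- im z)) \* (fun x => (n x)^-1)).
  by apply: measurable_funM => //; exact: measurable_cst.
apply/funext => x /=; rewrite /resolvent imV sqr_normcE reD imD reN imN/=.
by rewrite oppr0 addr0.
Qed.

(** A quantitative form of [z] lying off the closure of [D]; all estimates on resolvents are
    expressed through [e]. *)
Definition apart D z e := 0 < e /\ forall x, D x -> e <= normc (z - x%:C).

Lemma apart_neq0 D z e x : apart D z e -> D x -> z - x%:C != 0.
Proof. by case=> e0 H Dx; rewrite -normc_gt0 (lt_le_trans e0)// H. Qed.

Lemma normc_resolvent D z e x : apart D z e -> D x -> normc (resolvent z x) <= e^-1.
Proof.
move=> zD Dx; have [e0 H] := zD; rewrite /resolvent normcV lef_pV2 ?posrE//; first exact: H.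
by rewrite normc_gt0 (apart_neq0 zD).
Qed.

Lemma bmeas_resolvent (D : set (measurableTypeR R)) z e : measurable D ->
  apart D z e -> bmeas D (resolvent z).
Proof.
move=> mD zD; have [mr mi] := measurable_resolvent z.
split; [exact: measurable_funS mr|exact: measurable_funS mi|].
by exists e^-1 => x Dx; exact: normc_resolvent zD Dx.
Qed.

(** The resolvent identity, from which both the Lipschitz bound and the first-order expansion
    follow. *)
Lemma resolventB D z z' e e' x : apart D z e -> apart D z' e' -> D x ->
  resolvent z' x - resolvent z x = - (z' - z) * (resolvent z' x * resolvent z x).
Proof.
move=> zD z'D Dx; have n0 := apart_neq0 zD Dx; have n0' := apart_neq0 z'D Dx.
by rewrite /resolvent; field; rewrite n0 n0'.
Qed.

Variables (mu : probability (measurableTypeR R) R) (D : set (measurableTypeR R)).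
Hypotheses (mD : measurable D) (D1 : mu D = 1%E).

Local Notation G z := (Cint mu D (resolvent z)).
Local Notation Q z := (Cint mu D (fun x => resolvent z x ^+ 2)).

Lemma bmeas_resolvent2 z e : apart D z e -> bmeas D (fun x => resolvent z x ^+ 2).
Proof.
move=> zD; have -> : (fun x => resolvent z x ^+ 2) = fun x => resolvent z x * resolvent z x.
  by apply/funext => x; rewrite expr2.
by apply: bmeasM; exact: bmeas_resolvent zD.
Qed.

Lemma normc_Cint_resolvent z e : apart D z e -> normc (G z) <= 2 * e^-1.
Proof.
move=> zD; apply: normc_Cint_le => //; first exact: bmeas_resolvent zD.
by move=> x Dx; exact: normc_resolvent zD Dx.
Qed.

Lemma normc_Cint_resolvent2 z e : apart D z e -> normc (Q z) <= 2 * e^-2.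
Proof.
move=> zD; apply: normc_Cint_le => //; first exact: bmeas_resolvent2 zD.
move=> x Dx; rewrite normcX -exprVn lerXn2r ?nnegrE ?normc_ge0 ?invr_ge0//.
  by case: zD => /ltW.
exact: normc_resolvent zD Dx.
Qed.

Lemma Cint_resolventB z z' e e' : apart D z e -> apart D z' e' ->
  G z' - G z = - (z' - z) * Cint mu D (fun x => resolvent z' x * resolvent z x).
Proof.
move=> zD z'D; have bz := bmeas_resolvent mD zD; have bz' := bmeas_resolvent mD z'D.
rewrite -CintB// -CintZ//; last exact: bmeasM.
by apply: eq_Cint => x Dx; rewrite (resolventB zD z'D).
Qed.

Lemma normc_Cint_resolventB z z' e e' : apart D z e -> apart D z' e' ->
  normc (G z' - G z) <= 2 * (normc (z' - z) / (e' * e)).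
Proof.
move=> zD z'D; rewrite (Cint_resolventB zD z'D) normcM normcN mulrCA.
apply: ler_wpM2l; first exact: normc_ge0.
apply: normc_Cint_le => //.
  by apply: bmeasM; [exact: bmeas_resolvent z'D|exact: bmeas_resolvent zD].
move=> x Dx; rewrite normcM invfM; apply: ler_pM; rewrite ?normc_ge0//.
  exact: normc_resolvent z'D Dx.
exact: normc_resolvent zD Dx.
Qed.

(** Applying the resolvent identity twice leaves a remainder quadratic in [z' - z]. The bound does
    not depend on the measure, so it can be used while the measure moves with time. *)
Lemma Cint_resolvent_expand z z' e e' : apart D z e -> apart D z' e' ->
  normc (G z' - G z + (z' - z) * Q z) <=
  2 * (normc (z' - z) ^+ 2 / (e' * e ^+ 2)).
Proof.
move=> zD z'D; have bz := bmeas_resolvent mD zD; have bz' := bmeas_resolvent mD z'D.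
have bzz := bmeas_resolvent2 zD.
rewrite (Cint_resolventB zD z'D) mulNr addrC -mulrBr -CintB//; last exact: bmeasM.
rewrite (eq_Cint mu (g := fun x => (z' - z) * (resolvent z' x * resolvent z x ^+ 2))); last first.
  move=> x Dx; rewrite expr2 -mulrBl -opprB (resolventB zD z'D Dx); ring.
rewrite CintZ//; last exact: bmeasM.
rewrite !normcM mulrA -expr2 mulrCA; apply: ler_wpM2l; first exact: exprn_ge0 (normc_ge0 _).
apply: normc_Cint_le => //; first exact: bmeasM.
move=> x Dx; rewrite normcM normcX invfM; apply: ler_pM; rewrite ?normc_ge0 ?exprn_ge0 ?normc_ge0//.
  exact: normc_resolvent z'D Dx.
rewrite -exprVn lerXn2r ?nnegrE ?normc_ge0 ?invr_ge0//.
  by case: zD => /ltW.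
exact: normc_resolvent zD Dx.
Qed.

End resolvent.

(** * Limits of complex-valued functions, tested with real radii *)

Section complex_limits.
Variable R : realType.

Lemma gt0_complexE (e : R[i]) : 0 < e -> e = (re e)%:C /\ 0 < re e.
Proof. by rewrite ltcE /= => /andP[/eqP ie re0]; split => //; case: e ie re0 => a b /= -> . Qed.

Lemma cvg_normcP (T : Type) (F : set_system T) {FF : Filter F} (f : T -> R[i]) (l : R[i]) :
  (f : T -> R[i]^o) @ F --> (l : R[i]^o) <->
  forall e : R, 0 < e -> \forall x \near F, normc (l - f x) < e.
Proof.
split=> [/cvgrPdist_lt fl e e0|H].
  have e0' : 0 < e%:C by rewrite ltcR.
  have := fl _ e0'; apply: filterS => x.
  by rewrite normc_normr ltcR.
apply/cvgrPdist_lt => e /gt0_complexE[-> e0].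
by have := H _ e0; apply: filterS => x; rewrite normc_normr ltcR.
Qed.

Lemma cvg_re (T : Type) (F : set_system T) {FF : Filter F} (f : T -> R[i]) (l : R[i]) :
  (f : T -> R[i]^o) @ F --> (l : R[i]^o) -> (fun x => re (f x)) @ F --> re l.
Proof.
move=> /cvg_normcP H; apply/cvgrPdist_lt => e e0.
by have := H _ e0; apply: filterS => x; apply: le_lt_trans; rewrite -reN -reD normc_Re.
Qed.

Lemma cvg_im (T : Type) (F : set_system T) {FF : Filter F} (f : T -> R[i]) (l : R[i]) :
  (f : T -> R[i]^o) @ F --> (l : R[i]^o) -> (fun x => im (f x)) @ F --> im l.
Proof.
move=> /cvg_normcP H; apply/cvgrPdist_lt => e e0.
by have := H _ e0; apply: filterS => x; apply: le_lt_trans; rewrite -imN -imD normc_Im.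
Qed.

Lemma cvg_complex (T : Type) (F : set_system T) {FF : Filter F} (f : T -> R[i]) (l : R[i]) :
  (fun x => re (f x)) @ F --> re l -> (fun x => im (f x)) @ F --> im l ->
  (f : T -> R[i]^o) @ F --> (l : R[i]^o).
Proof.
move=> /cvgrPdist_lt fr /cvgrPdist_lt fi; apply/cvg_normcP => e e0.
have e2 : 0 < e / 2 by rewrite divr_gt0.
apply: filterS2 (fr _ e2) (fi _ e2) => x h1 h2.
apply: (le_lt_trans (normc_le_ReIm _)); rewrite reD imD reN imN.
by rewrite (splitr e) ltrD.
Qed.

Lemma cvg_realc (T : Type) (F : set_system T) {FF : Filter F} (f : T -> R) (l : R) :
  f @ F --> l -> ((fun x => (f x)%:C) : T -> R[i]^o) @ F --> (l%:C : R[i]^o).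
Proof.
move=> fl; apply: (@cvg_complex _ F _ (fun x => (f x)%:C) l%:C); first exact: fl.
exact: cvg_cst.
Qed.

Lemma cvgcB (T : Type) (F : set_system T) {FF : Filter F} (f g : T -> R[i]) (a c : R[i]) :
  (f : T -> R[i]^o) @ F --> (a : R[i]^o) -> (g : T -> R[i]^o) @ F --> (c : R[i]^o) ->
  ((fun x => f x - g x) : T -> R[i]^o) @ F --> (a - c : R[i]^o).
Proof.
by move=> fa gc; exact: (@cvgB R[i] R[i]^o _ _ _ f g a c fa gc).
Qed.

Lemma cvgcD (T : Type) (F : set_system T) {FF : Filter F} (f g : T -> R[i]) (a c : R[i]) :
  (f : T -> R[i]^o) @ F --> (a : R[i]^o) -> (g : T -> R[i]^o) @ F --> (c : R[i]^o) ->
  ((fun x => f x + g x) : T -> R[i]^o) @ F --> (a + c : R[i]^o).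
Proof.
by move=> fa gc; exact: (@cvgD R[i] R[i]^o _ _ _ f g a c fa gc).
Qed.

Lemma cvgcM (T : Type) (F : set_system T) {FF : Filter F} (f g : T -> R[i]) (a c : R[i]) :
  (f : T -> R[i]^o) @ F --> (a : R[i]^o) -> (g : T -> R[i]^o) @ F --> (c : R[i]^o) ->
  ((fun x => f x * g x) : T -> R[i]^o) @ F --> (a * c : R[i]^o).
Proof.
by move=> fa gc; exact: (@cvgM R[i] _ _ _ f g a c fa gc).
Qed.

Lemma nbhs0_normcP (P : R[i] -> Prop) :
  (\forall z \near (0 : R[i]^o)^', P z) <->
  exists2 e : R, 0 < e & forall z, z != 0 -> normc z < e -> P z.
Proof.
split.
  rewrite /= /dnbhs /within /= => /nbhs_ballP[e /= /gt0_complexE[ee e0]] H.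
  exists (re e) => // z z0 ze; apply: H => //.
  by rewrite -ball_normE /= sub0r normrN normc_normr ee ltcR.
move=> [e e0 H]; rewrite /= /dnbhs /within /=.
apply/nbhs_ballP; exists e%:C; first by rewrite /= ltcR.
move=> z; rewrite -ball_normE /= sub0r normrN normc_normr ltcR => ze z0.
exact: H.
Qed.

End complex_limits.

(** * Complex derivative of the Cauchy transform, and weak continuity of its derivative in time *)

Section cauchy_limits.
Variable R : realType.
Implicit Types (z : R[i]) (mu : probability (measurableTypeR R) R).

Local Notation Rp := (`[0, +oo[%classic : set R).

Lemma apart_im (D : set R) z : im z != 0 -> apart D z `|im z|.
Proof.
move=> z0; split; first by rewrite normr_gt0.
move=> x _; apply: le_trans (normc_Im _); by rewrite imD imN /= oppr0 addr0.
Qed.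

Lemma continuous_resolvent z : im z != 0 -> continuous (fun x : R => re (resolvent z x)) /\
  continuous (fun x : R => im (resolvent z x)).
Proof.
move=> z0; pose n (x : R) := (re z - x) * (re z - x) + im z ^+ 2.
have n0 x : n x != 0.
  by rewrite gt_eqF// ltr_wpDl -?expr2 ?sqr_ge0// exprn_even_gt0.
have cB : continuous (fun x : R => re z - x).
  by move=> x; apply: cvgB; [exact: cvg_cst|exact: cvg_id].
have cn : continuous n.
  by move=> x; apply: cvgD; [apply: cvgM; exact: cB|exact: cvg_cst].
have cV : continuous (fun x => (n x)^-1).
  by move=> x; apply: cvgV => //; exact: cn.
split.
  have -> : (fun x : R => re (resolvent z x)) = (fun x => (re z - x) * (n x)^-1).
    apply/funext => x; rewrite /n -expr2 /resolvent reV sqr_normcE reD imD reN imN/=.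
    by rewrite oppr0 addr0.
  by move=> x; apply: cvgM; [exact: cB|exact: cV].
have -> : (fun x : R => im (resolvent z x)) = (fun x => - im z * (n x)^-1).
  apply/funext => x; rewrite /n -expr2 /resolvent imV sqr_normcE reD imD reN imN/=.
  by rewrite oppr0 addr0.
by move=> x; apply: cvgM; [exact: cvg_cst|exact: cV].
Qed.

Lemma continuous_resolvent2 z : im z != 0 -> continuous (fun x : R => re (resolvent z x ^+ 2)) /\
  continuous (fun x : R => im (resolvent z x ^+ 2)).
Proof.
move=> z0; have [cr ci] := continuous_resolvent z0; split.
  have -> : (fun x : R => re (resolvent z x ^+ 2)) =
      (fun x => re (resolvent z x) * re (resolvent z x) - im (resolvent z x) * im (resolvent z x)).
    by apply/funext => x; rewrite expr2 reM.
  by move=> x; apply: cvgB; apply: cvgM; [exact: cr|exact: cr|exact: ci|exact: ci].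
have -> : (fun x : R => im (resolvent z x ^+ 2)) =
    (fun x => re (resolvent z x) * im (resolvent z x) + im (resolvent z x) * re (resolvent z x)).
  by apply/funext => x; rewrite expr2 imM.
by move=> x; apply: cvgD; apply: cvgM; [exact: cr|exact: ci|exact: ci|exact: cr].
Qed.

(** Off the real axis the real and imaginary parts of [1 / (z - x)^2] are bounded continuous
    functions of [x], hence admissible test functions. *)
Lemma weakly_continuous_resolvent2 (m : R -> probability (measurableTypeR R) R) z (s : R) :
  weakly_continuous m -> im z != 0 -> 0 <= s ->
  ((fun r => Cint (m r) Rp (fun x => resolvent z x ^+ 2)) : R -> R[i]^o)
     @ within Rp (nbhs s) --> (Cint (m s) Rp (fun x => resolvent z x ^+ 2) : R[i]^o).
Proof.
move=> wm z0 s0; have [cr ci] := continuous_resolvent2 z0.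
have bd x : normc (resolvent z x ^+ 2) <= `|im z|^-2.
  rewrite normcX -exprVn lerXn2r ?nnegrE ?normc_ge0 ?invr_ge0//.
  exact: (normc_resolvent (apart_im setT z0) I).
have conv (g : R -> R) : continuous g -> (forall x, `|g x| <= `|im z|^-2) ->
    (fun r => \int[m r]_(x in Rp) g x) @ within Rp (nbhs s) --> \int[m s]_(x in Rp) g x.
  move=> cg gb; have := wm g (continuous_subspaceT cg) _.
  have gB : [bounded g x | x in Rp].
    exists (`|im z|^-2); split; first exact: num_real.
    by move=> M zM x _ /=; exact: le_trans (gb x) (ltW zM).
  move=> /(_ gB) /subspace_continuousP; apply.
  by rewrite /= in_itv/= s0.
apply: (@cvg_complex _ _ _ _ (fun r => Cint (m r) Rp (fun x => resolvent z x ^+ 2))) => /=.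
  apply: (conv (fun x => re (resolvent z x ^+ 2))) => // x.
  exact: le_trans (normc_Re _) (bd x).
apply: (conv (fun x => im (resolvent z x ^+ 2))) => // x.
exact: le_trans (normc_Im _) (bd x).
Qed.

Variable mu : probability (measurableTypeR R) R.
Hypothesis mu1 : mu Rp = 1%E.

Lemma derive1_cauchy_transform z : im z != 0 ->
  derive1 (cauchy_transform mu : R[i]^o -> R[i]^o) z = - Cint mu Rp (fun x => resolvent z x ^+ 2).
Proof.
move=> z0; set Q := Cint _ _ _; pose d : R := `|im z|.
have d0 : 0 < d by rewrite normr_gt0.
have mRp : measurable (Rp : set (measurableTypeR R)) by exact: measurable_itv.
apply: cvg_lim. exact: (@norm_hausdorff R[i] R[i]^o).
(* For [normc h < d / 2] the point [h + z] stays at distance [d / 2] from the real axis. [C] is the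
   resulting coefficient of the quadratic remainder, and [normc h < e / C] makes that remainder
   smaller than [e * normc h]. *)
apply/cvg_normcP => e e0.
apply/nbhs0_normcP; pose C := 2 * ((d / 2)^-1 * d^-2).
have C0 : 0 < C by rewrite !mulr_gt0 ?invr_gt0 ?exprn_gt0 ?divr_gt0.
exists (Num.min (d / 2) (e / C)).
  by rewrite lt_min !divr_gt0.
move=> h h0; rewrite lt_min => /andP[hd he].
have zh : apart Rp (h + z) (d / 2).
  split; first by rewrite divr_gt0.
  move=> x _; apply: le_trans (normc_Im _); rewrite !imD imN /= oppr0 addr0.
  have := lerB_normD (im z) (im h); rewrite [im z + _]addrC.
  have := normc_Im h; rewrite -/d => h1 h2; lra.
have := Cint_resolvent_expand mRp mu1 (apart_im Rp z0) zh; rewrite -/d -/Q addrK => H.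
have hn : 0 < normc h by rewrite normc_gt0.
rewrite -(ltr_pM2l hn) -normcM -normcN.
rewrite [X in normc X](_ : _ =
  cauchy_transform mu (h + z) - cauchy_transform mu z + h * Q); last first.
  rewrite /GRing.scale /=; field.
  exact: h0.
apply: (le_lt_trans H).
have -> : 2 * (normc h ^+ 2 / (d / 2 * d ^+ 2)) = normc h * (normc h * C).
  by rewrite /C; field; rewrite gt_eqF.
by rewrite ltr_pM2l// -ltr_pdivlMr.
Qed.

End cauchy_limits.

(** * Gronwall backwards in time *)

Section time_derivative.
Variable R : realType.
Implicit Types (g : R -> R[i]) (s : R) (l : R[i]).
Local Notation Rp := (`[0, +oo[%classic : set R).

(** The form with the quotient cleared also covers [s' = s] and treats the one-sided case [s = 0]
    uniformly. *)
Lemma is_time_derivativeP g s l : is_time_derivative g s l <->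
  forall e : R, 0 < e -> exists2 d : R, 0 < d & forall s' : R, 0 <= s' -> `|s' - s| < d ->
    normc (g s' - g s - (s' - s)%:C * l) <= e * `|s' - s|.
Proof.
split=> [/cvg_normcP H e e0|H].
  have := H _ e0; rewrite /= /within /= /dnbhs /within/=.
  move=> /nbhs_ballP[d /= d0 K]; exists d => // s' s'0 sd.
  have [->|ss] := eqVneq s' s; first by rewrite !subrr mul0r subrr normc0 normr0 mulr0.
  have hn : s' - s != 0 by rewrite subr_eq0.
  have hc : (s' - s)%:C != 0 by rewrite -(rmorph0 (real_complex R)) (inj_eq (@complexI R)).
  have : normc (l - ((s' - s)^-1)%:C * (g s' - g s)) < e.
    apply: K => //=; first by rewrite /ball /= distrC.
    by rewrite in_itv /= s'0.
  have n0 : 0 < `|s' - s| by rewrite normr_gt0.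
  rewrite -(ltr_pM2r n0) => /ltW; apply: le_trans; rewrite -normcR -normcM.
  rewrite -normcN le_eqVlt; apply/orP; left; apply/eqP; congr normc.
  by rewrite fmorphV; field; rewrite -rmorphB; exact: hc.
rewrite /is_time_derivative; apply/cvg_normcP => e e0.
have e2 : 0 < e / 2 by rewrite divr_gt0.
have [d d0 K] := H _ e2.
rewrite /= /within /= /dnbhs /within/=.
apply/nbhs_ballP; exists d => // s'; rewrite /ball /= distrC => sd ss.
rewrite in_itv/= andbT => s'0.
have hn : s' - s != 0 by rewrite subr_eq0.
have hc : (s' - s)%:C != 0 by rewrite -(rmorph0 (real_complex R)) (inj_eq (@complexI R)).
have n0 : 0 < `|s' - s| by rewrite normr_gt0.
rewrite -(ltr_pM2r n0) -normcR -normcM normcR.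
apply: (@le_lt_trans _ _ (e / 2 * `|s' - s|)); last by rewrite ltr_pM2r// ltr_pdivrMr//; lra.
apply: le_trans (K _ s'0 sd); rewrite -normcN le_eqVlt; apply/orP; left; apply/eqP; congr normc.
by rewrite fmorphV; field; rewrite -rmorphB; exact: hc.
Qed.

Lemma cvg_time_derivative g s l : is_time_derivative g s l ->
  (g : R -> R[i]^o) @ within Rp (nbhs s) --> (g s : R[i]^o).
Proof.
move=> /is_time_derivativeP /(_ 1 ltr01)[d d0 H].
apply/cvg_normcP => e e0.
pose K := 1 + normc l.
have K0 : 0 < K by rewrite ltr_pwDl// normc_ge0.
rewrite /= /within /=; apply/nbhs_ballP; exists (Num.min d (e / K)).
  by rewrite /= lt_min d0 divr_gt0.
move=> s'; rewrite -ball_normE /= distrC lt_min in_itv/= andbT => /andP[sd se] s'0.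
have := H _ s'0 sd; rewrite mul1r => {}H.
rewrite normc_distrC -[_ - _](subrK ((s' - s)%:C * l)).
apply: (le_lt_trans (le_normcD _ _)).
apply: (@le_lt_trans _ _ (`|s' - s| * K)); last by rewrite -ltr_pdivlMr.
by rewrite /K mulrDr mulr1 normcM normcR lerD2r.
Qed.

Lemma is_derive_re g s l : 0 < s -> is_time_derivative g s l ->
  is_derive s 1 (fun x => re (g x)) (re l).
Proof.
move=> s0 /is_time_derivativeP H.
have L : (fun h => h^-1 *: (((fun x => re (g x)) \o shift s) (h *: 1) - re (g s)))
    @ 0^' --> re l.
  apply/cvgrPdist_le => e e0; have [d d0 K] := H _ e0.
  (* A radius at most [s] keeps [h + s] nonnegative, which turns the limit within [[0, +oo[] into a
     two-sided one. *)
  apply/nbhs_ballP; exists (Num.min d s); first by rewrite /= lt_min d0.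
  move=> h; rewrite -ball_normE /= sub0r normrN lt_min => /andP[hd hs] h0.
  have h0' : 0 < `|h| by rewrite normr_gt0.
  have sh : 0 <= h + s by have := ler_norm (- h); rewrite normrN; lra.
  rewrite -(ler_pM2r h0') -normrM.
  have := K _ sh; rewrite addrK => /(_ hd); apply: le_trans.
  apply: le_trans (normc_Re _); rewrite !(reD, reN) reM /= mul0r subr0.
  rewrite /GRing.scale/= mulr1 -normrN le_eqVlt; apply/orP; left; apply/eqP; congr `|_|.
  by field.
apply: DeriveDef; first by apply/cvg_ex; exists (re l).
exact/cvg_lim.
Qed.

(** Multiplication by [-i] turns imaginary parts into real parts, so the statement on [im] follows
    from the one on [re]. *)
Lemma is_time_derivative_Mi g s l : is_time_derivative g s l ->
  is_time_derivative (fun x => - ('i%C * g x)) s (- ('i%C * l)).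
Proof.
move=> /is_time_derivativeP H; apply/is_time_derivativeP => e e0.
have [d d0 K] := H _ e0; exists d => // s' s'0 sd; apply: le_trans (K _ s'0 sd).
rewrite [X in normc X](_ : _ = - 'i%C * (g s' - g s - (s' - s)%:C * l)); last by ring.
by rewrite normcM normcN /= expr0n expr1n add0r sqrtr1 mul1r.
Qed.

Lemma is_derive_im g s l : 0 < s -> is_time_derivative g s l ->
  is_derive s 1 (fun x => im (g x)) (im l).
Proof.
move=> s0 /is_time_derivative_Mi /(is_derive_re s0).
have E (z : R[i]) : re (- ('i%C * z)) = im z by rewrite reN reM /= mul0r mul1r sub0r opprK.
by rewrite E; under eq_fun do rewrite E.
Qed.

(** The function [exp (2 C s) |u|^2] has derivative [2 exp (2 C s) (C + re A) |u|^2 >= 0]. It is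
    nonnegative, nondecreasing and zero at [t], hence zero before [t]. *)
Lemma gronwall_backward (u A : R -> R[i]) (a t C : R) : 0 <= a -> 
  (forall s, a <= s <= t -> is_time_derivative u s (A s * u s)) ->
  (forall s, a <= s <= t -> normc (A s) <= C) ->
  u t = 0 -> forall s, a <= s <= t -> u s = 0.
Proof.
move=> a0 uA AC ut0.
pose phi s := expR (2 * C * s) * (re (u s) ^+ 2 + im (u s) ^+ 2).
have cphi : {within `[a, t], continuous phi}.
  apply/subspace_continuousP => s; rewrite /= in_itv /= => sat.
  have cu := cvg_time_derivative (uA _ sat).
  have sub : within `[a, t] (nbhs s) `=>` within Rp (nbhs s).
    move=> P; rewrite /within /=; apply: filterS => x Px /=; rewrite in_itv/= => /andP[ax _].
    by apply: Px; rewrite in_itv/= (le_trans a0).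
  have cr : (fun x => re (u x)) @ within `[a, t] (nbhs s) --> re (u s).
    by apply: cvg_re; apply: cvg_trans cu; exact: cvg_app.
  have ci : (fun x => im (u x)) @ within `[a, t] (nbhs s) --> im (u s).
    by apply: cvg_im; apply: cvg_trans cu; exact: cvg_app.
  apply: cvgM.
    apply: (@cvg_trans _ ((fun x => expR (2 * C * x)) @ nbhs s)).
      by apply: cvg_app; exact: cvg_within.
    apply: continuous_comp; last exact: continuous_expR.
    by apply: cvgM; [exact: cvg_cst|exact: cvg_id].
  by apply: cvgD; rewrite expr2; apply: cvgM.
have dphi s : s \in `]a, t[ -> is_derive s 1 phi
    (expR (2 * C * s) * (2 * C * (re (u s) ^+ 2 + im (u s) ^+ 2)
      + 2 * (re (A s * u s) * re (u s) + im (A s * u s) * im (u s)))).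
  rewrite in_itv/= => /andP[as_ st].
  have sat : a <= s <= t by rewrite !ltW.
  have s0 : 0 < s by rewrite (le_lt_trans a0).
  have dr := is_derive_re s0 (uA _ sat).
  have di := is_derive_im s0 (uA _ sat).
  rewrite /phi; apply: is_derive_eq.
  rewrite /GRing.scale/=; ring.
have mono : forall x y, a <= x -> x <= y -> y <= t -> phi x <= phi y.
  apply: ger0_derive1_ndecr => //.
    by move=> x /dphi[].
  move=> x xat; rewrite derive1E; have [_ ->] := dphi _ xat.
  apply: mulr_ge0; first exact: expR_ge0.
  have xat' : a <= x <= t by move: xat; rewrite in_itv/= => /andP[? ?]; rewrite !ltW.
  have Ax := AC _ xat'.
  have := le_trans (normc_Re (A x)) Ax; rewrite ler_norml => /andP[h1 h2].
  rewrite reM imM.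
  have -> : 2 * C * (re (u x) ^+ 2 + im (u x) ^+ 2) + 2 *
     ((re (A x) * re (u x) - im (A x) * im (u x)) * re (u x) +
      (re (A x) * im (u x) + im (A x) * re (u x)) * im (u x)) =
     2 * ((C + re (A x)) * (re (u x) ^+ 2 + im (u x) ^+ 2)) by ring.
  by apply: mulr_ge0 => //; apply: mulr_ge0; [lra|rewrite addr_ge0 ?sqr_ge0].
move=> s /andP[as_ st].
have := mono _ _ as_ st (lexx t).
rewrite /phi ut0 /= expr0n /= addr0 mulr0 -sqr_normcE.
rewrite pmulr_rle0 ?expR_gt0// => h.
apply/eqP; rewrite -normc_eq0 -sqrf_eq0 eq_le h; exact: sqr_ge0.
Qed.

End time_derivative.

(** * Backward characteristics *)

Section characteristics.
Variables (R : realType) (lambda : R) (m : R -> probability (measurableTypeR R) R).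
Local Notation Rp := (`[0, +oo[%classic : set R).

Lemma P0_Rp (mu : probability (measurableTypeR R) R) : P0 mu -> mu Rp = 1%E.
Proof.
move=> [M M1].
have mI (i : interval R) : measurable ([set` i] : set (measurableTypeR R)).
  exact: measurable_itv.
apply/eqP; rewrite eq_le; apply/andP; split; first exact: probability_le1.
rewrite -M1; apply: le_measure; rewrite ?inE//.
by move=> x /=; rewrite !in_itv/= => /andP[-> _].
Qed.

(** The integrand [z / (z - x)] has imaginary part [- x im z / |z - x|^2], whose sign is fixed
    because the mass sits on [x >= 0]. *)
Lemma im_cauchy_le0 (mu : probability (measurableTypeR R) R) (z : R[i]) :
  mu Rp = 1%E -> 0 < im z -> im (z * cauchy_transform mu z) <= 0.
Proof.
move=> mu1 z0.
have mRp : measurable (Rp : set (measurableTypeR R)) by exact: measurable_itv.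
have zn0 : im z != 0 by rewrite gt_eqF.
have bk := bmeas_resolvent mRp (apart_im Rp zn0).
rewrite (_ : cauchy_transform mu z = Cint mu Rp (resolvent z))// -CintZ//=.
apply: (@le_trans _ _ (\int[mu]_(x in Rp) 0)%R); last first.
  by rewrite (Rintegral_probability_cst 0 mRp mu1).
apply: le_Rintegral => //.
- by apply: (bmeas_Im_integrable _ mRp (bmeasM _ bk)); exact: bmeas_cst.
- by apply: (bmeas_Re_integrable _ mRp (bmeas_cst _ 0)).
move=> x; rewrite /= in_itv/= andbT => x0.
rewrite imM /resolvent reV imV reD reN imD imN/= oppr0 addr0.
set n := normc _ ^+ 2.
rewrite [X in X <= _](_ : _ = - (x * im z / n)); last by ring.
rewrite oppr_le0; apply: divr_ge0; first by rewrite mulr_ge0// ltW.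
exact: exprn_ge0 (normc_ge0 _).
Qed.

Hypothesis mp : is_m_process lambda m.
Variables (t : R) (v w : R[i]).

(* The characteristic through [(t, v)] of the PDE, on which [G s (Z s) = w / p s]; the
   defect is [u s = p s * G s (Z s) - w], free of denominators. *)
Let G s z := cauchy_transform (m s) z.
Let Q s z := Cint (m s) Rp (fun x => resolvent z x ^+ 2).
Let p (s : R) : R[i] := 1 - (t - s)%:C * w.
Let Z (s : R) : R[i] := p s * (p s * v + ((1 - lambda) * (t - s))%:C).
Let l s : R[i] := 2 * w * p s * v + (1 - lambda)%:C * ((t - s)%:C * w - p s).

(** [Z] is a quadratic polynomial in [s], so its second-order expansion is exact and [l] is its
    derivative. *)
Let ZE s s' : Z s' - Z s = (s' - s)%:C * l s +
  (s' - s)%:C ^+ 2 * (w ^+ 2 * v - (1 - lambda)%:C * w).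
Proof. by rewrite /Z /l /p !(rmorphM, rmorphB)/=; ring. Qed.

Let dZ s : is_time_derivative Z s (l s).
Proof.
apply/is_time_derivativeP => e e0.
set c0 := w ^+ 2 * v - (1 - lambda)%:C * w.
have c00 : 0 < normc c0 + 1 by rewrite ltr_wpDl// normc_ge0.
exists (e / (normc c0 + 1)); first by rewrite divr_gt0.
move=> s' _ hs; rewrite ZE addrC addKr normcM normcX normcR expr2 -mulrA mulrC.
rewrite ler_wpM2r//; move: hs; rewrite ltr_pdivlMr// => /ltW; apply: le_trans.
by rewrite ler_wpM2l// lerDl.
Qed.

(** Chain rule along the curve: [- Q] is the space derivative of [G], and the equation has been used
    to express the time derivative at a fixed point through [Q] and [G]. *)
Let dG s : 0 <= s -> 0 < im (Z s) ->
  is_time_derivative (fun s' => G s' (Z s')) s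
   (- l s * Q s (Z s) + ((2 * Z s * G s (Z s) - (1 - lambda)%:C) * Q s (Z s) - G s (Z s) ^+ 2)).
Proof.
move=> s0 zs0; have [mP0 mw mpde] := mp.
have m1 r : 0 <= r -> m r Rp = 1%E by move=> /mP0 /P0_Rp.
have mRp : measurable (Rp : set (measurableTypeR R)) by exact: measurable_itv.
have zn0 : im (Z s) != 0 by rewrite gt_eqF.
have [dt [Hdt]] := mpde s (Z s) s0 zs0.
rewrite (derive1_cauchy_transform (m1 s s0) zn0).
rewrite -/(Q s (Z s)) -/(G s (Z s)) => Hpde.
have {Hpde} -> : (2 * Z s * G s (Z s) - (1 - lambda)%:C) * Q s (Z s) - G s (Z s) ^+ 2 = dt.
  by apply/eqP; rewrite -subr_eq0 -oppr_eq0 -{}Hpde; apply/eqP; ring.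
set q := Q s (Z s); pose d : R := im (Z s).
set c0 := w ^+ 2 * v - (1 - lambda)%:C * w.
pose B := normc (l s) + normc c0 + 1.
have B0 : 0 < B by rewrite /B ltr_wpDl// addr_ge0 ?normc_ge0.
pose K := 2 * (B ^+ 2 / (d / 2 * d ^+ 2)) + normc c0 * (2 * d^-2) + 1.
have d0 : 0 < d by [].
have K0 : 0 < K.
  rewrite /K ltr_wpDl// addr_ge0// !mulr_ge0 ?normc_ge0 ?invr_ge0 ?exprn_ge0//; try exact: ltW.
  by rewrite mulr_ge0 ?exprn_ge0 ?divr_ge0// ltW.
have im_d : `|im (Z s)| = d by rewrite gtr0_norm.
apply/is_time_derivativeP => e e0.
have e3 : 0 < e / 3 by rewrite divr_gt0.
have /is_time_derivativeP/(_ _ e3)[d1 d10 H1] := Hdt.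
have e3l : 0 < e / 3 / B by rewrite divr_gt0.
have /cvg_normcP/(_ _ e3l) := weakly_continuous_resolvent2 mw zn0 s0.
rewrite /= /within /= => /nbhs_ballP[d2 /= d20 H2].
(* [d1] controls the time increment at the fixed point [Z s], [d2] the variation of [Q] in time.
   Below [1] the curve moves by at most [B |h|], below [d / 2 / B] it stays above height [d / 2],
   and [e / 3 / K] absorbs the terms quadratic in [h]. *)
exists (Num.min (Num.min d1 d2) (Num.min 1 (Num.min (d / 2 / B) (e / 3 / K)))).
  by rewrite !lt_min d10 d20 ltr01 !divr_gt0.
move=> s' s'0; rewrite !lt_min => /andP[/andP[hd1 hd2] /andP[h1 /andP[hdB heK]]].
have {}H1 := H1 _ s'0 hd1.
have {}H2 : normc (q - Q s' (Z s)) < e / 3 / B.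
  by apply: H2; rewrite /= ?/ball/= 1?distrC// in_itv/= s'0.
set h := s' - s in h1 hd1 hd2 hdB heK H1 *.
have hZ : normc (Z s' - Z s) <= `|h| * B.
  rewrite ZE -/h -/c0 expr2 -mulrA -mulrDr normcM normcR ler_wpM2l//.
  apply: (le_trans (le_normcD _ _)); rewrite /B -addrA lerD2l normcM normcR.
  apply: (@le_trans _ _ (normc c0)); last by rewrite lerDl.
  by rewrite ler_piMl ?normc_ge0// ltW.
have apart_s : apart Rp (Z s) d by rewrite -im_d; exact: apart_im.
have apart_s' : apart Rp (Z s') (d / 2).
  split; first by rewrite divr_gt0.
  move=> x _; apply: le_trans (normc_Im _); rewrite imD imN /= oppr0 addr0.
  apply: le_trans (ler_norm _).
  have hb : `|h| * B <= d / 2 by rewrite -ler_pdivlMr// ltW.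
  have := le_trans (normc_Im _) (le_trans hZ hb); rewrite imD imN ler_norml -/d.
  by move=> /andP[+ _]; lra.
have X1 := Cint_resolvent_expand mRp (m1 _ s'0) apart_s apart_s'.
have X2 := normc_Cint_resolvent2 mRp (m1 _ s'0) apart_s.
rewrite -/(Q s' (Z s)) in X1 X2.
(* The four pieces are the space increment at time [s'] to second order, the drift of [Q] in time,
   the quadratic part of [Z s' - Z s], and the time increment at [Z s]. *)
have -> : G s' (Z s') - G s (Z s) - h%:C * (- l s * q + dt) =
   (G s' (Z s') - G s' (Z s) + (Z s' - Z s) * Q s' (Z s)) +
   (h%:C * l s * (q - Q s' (Z s))) - h%:C ^+ 2 * c0 * Q s' (Z s) +
   (G s' (Z s) - G s (Z s) - h%:C * dt).
  by rewrite ZE -/h -/c0; ring.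
apply: (le_trans (le_normcD _ _)).
have -> : e * `|h| = e / 3 * `|h| + e / 3 * `|h| + e / 3 * `|h| by field.
apply: lerD; last exact: H1.
rewrite -addrA addrCA; apply: (le_trans (le_normcD _ _)); apply: lerD.
  rewrite !normcM normcR [X in _ <= X]mulrC -mulrA ler_wpM2l//.
  apply: (@le_trans _ _ (B * (e / 3 / B))); last by rewrite mulrC divfK// gt_eqF.
  apply: ler_pM; rewrite ?normc_ge0//; last exact: ltW.
  by rewrite /B -addrA lerDl addr_ge0// normc_ge0.
apply: (le_trans (ler_normcBD _ _)).
apply: (@le_trans _ _ (`|h| ^+ 2 * K)); last first.
  by rewrite expr2 -mulrA mulrC ler_wpM2r// -ler_pdivlMr// ltW.
apply: (@le_trans _ _ (`|h| ^+ 2 * (2 * (B ^+ 2 / (d / 2 * d ^+ 2))) +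
   `|h| ^+ 2 * (normc c0 * (2 * d^-2)))); last first.
  by rewrite -mulrDr ler_wpM2l ?exprn_ge0// /K lerDl.
apply: lerD.
  apply: (le_trans X1); rewrite [X in _ <= X]mulrCA ler_pM2l// [X in _ <= X]mulrA. apply: ler_wpM2r.
    by rewrite invr_ge0; apply: mulr_ge0; rewrite ?exprn_ge0 ?divr_ge0// ltW.
  by rewrite -exprMn lerXn2r ?nnegrE ?normc_ge0// mulr_ge0// ltW.
rewrite normcM normcM normcX normcR -[X in X <= _]mulrA; apply: ler_wpM2l; first exact: exprn_ge0.
by apply: ler_wpM2l; first exact: normc_ge0.
Qed.

Let u s := p s * G s (Z s) - w.

(* The cancellation that makes the equation for [u] linear and homogeneous. *)
Let du s : 0 <= s -> 0 < im (Z s) -> is_time_derivative u s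
  ((2 * Z s * Q s (Z s) - G s (Z s)) * u s).
Proof.
move=> s0 zs0; have Hg := dG s0 zs0; set b := (X in is_time_derivative _ _ X) in Hg.
have -> : (2 * Z s * Q s (Z s) - G s (Z s)) * u s = w * G s (Z s) + p s * b.
  rewrite /b /u /l; set q := Q s _; set g := G s _.
  (* The transport coefficient equals the speed [l s] plus a multiple of the defect, so the terms
     [l s * Q] cancel and only multiples of [u s] remain. *)
  have -> : 2 * Z s * g - (1 - lambda)%:C =
      2 * w * p s * v + (1 - lambda)%:C * ((t - s)%:C * w - p s)
      + 2 * (p s * v + ((1 - lambda) * (t - s))%:C) * (p s * g - w).
    by rewrite /Z /p !(rmorphM, rmorphB)/=; ring.
  by rewrite {1}/Z; ring.
apply/is_time_derivativeP => e e0.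
have P0 : 0 < normc (p s) + 1 by rewrite ltr_wpDl// normc_ge0.
have W0 : 0 < normc w + 1 by rewrite ltr_wpDl// normc_ge0.
have e1 : 0 < e / 2 / (normc (p s) + 1) by rewrite !divr_gt0.
have e2 : 0 < e / 2 / (normc w + 1) by rewrite !divr_gt0.
have /is_time_derivativeP/(_ _ e1)[d1 d10 H1] := Hg.
have /cvg_normcP/(_ _ e2) := cvg_time_derivative Hg.
rewrite /= /within /= => /nbhs_ballP[d2 /= d20 H2].
exists (Num.min d1 d2); first by rewrite lt_min d10 d20.
move=> s' s'0; rewrite lt_min => /andP[hd1 hd2].
have {}H1 := H1 _ s'0 hd1.
have {}H2 : normc (G s (Z s) - G s' (Z s')) < e / 2 / (normc w + 1).
  by apply: H2; rewrite /= ?/ball/= 1?distrC// in_itv/= s'0.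
set h := s' - s in H1 *.
have -> : u s' - u s - h%:C * (w * G s (Z s) + p s * b) =
   p s * (G s' (Z s') - G s (Z s) - h%:C * b) - h%:C * (w * (G s (Z s) - G s' (Z s'))).
  by rewrite /u {1}/p {3}/p /h /p !rmorphB /=; ring.
apply: (le_trans (ler_normcBD _ _)).
have -> : e * `|h| = e / 2 * `|h| + e / 2 * `|h| by field.
apply: lerD.
  rewrite normcM; apply: (le_trans (ler_wpM2l (normc_ge0 _) H1)).
  rewrite mulrA ler_wpM2r// mulrCA -[leRHS]mulr1 ler_wpM2l// ?ler_pdivrMr ?mul1r ?lerDl//.
  by rewrite divr_ge0// ltW.
rewrite normcM normcR mulrC ler_wpM2r// normcM.
apply: (le_trans (ler_wpM2l (normc_ge0 _) (ltW H2))).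
rewrite mulrCA -[leRHS]mulr1 ler_wpM2l// ?ler_pdivrMr ?mul1r ?lerDl//.
by rewrite divr_ge0// ltW.
Qed.

Hypotheses (t0 : 0 <= t) (v0 : 0 < im v) (wE : w = G t v).

Let pt : p t = 1.
Proof. by rewrite /p subrr rmorph0 mul0r subr0. Qed.

Let Zt : Z t = v.
Proof. by rewrite /Z pt subrr mulr0 rmorph0 addr0 !mul1r. Qed.

Let ut : u t = 0.
Proof. by rewrite /u pt Zt mul1r wE subrr. Qed.

Let normc_Z s : 0 <= s <= t ->
  normc (Z s) <= (1 + t * normc w) * ((1 + t * normc w) * normc v + `|1 - lambda| * t).
Proof.
move=> /andP[s0 st].
have ts : `|t - s| <= t by rewrite ger0_norm ?subr_ge0// lerBlDr lerDl.
have np : normc (p s) <= 1 + t * normc w.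
  apply: (le_trans (ler_normcBD _ _)); rewrite normc1 lerD2l normcM normcR.
  by rewrite ler_wpM2r// normc_ge0.
rewrite normcM; apply: ler_pM; rewrite ?normc_ge0//.
apply: (le_trans (le_normcD _ _)); apply: lerD.
  by rewrite normcM ler_wpM2r// normc_ge0.
by rewrite normcR normrM ler_wpM2l.
Qed.

(** A bootstrap. While the height is at least [im v / 2], the coefficient in [du] is bounded and [u]
    vanishes by Gronwall. The speed of the curve is then the true characteristic speed, whose
    imaginary part is nonpositive, so the height is in fact at least [im v]. *)
Let vanish a : 0 <= a -> (forall s, a <= s <= t -> im v / 2 <= im (Z s)) ->
  forall s, a <= s <= t -> u s = 0 /\ im v <= im (Z s).
Proof.
move=> a0 Hy; set y := im v / 2; have y0 : 0 < y by rewrite divr_gt0.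
have mRp : measurable (Rp : set (measurableTypeR R)) by exact: measurable_itv.
have pos s : a <= s <= t -> 0 < im (Z s) by move=> /Hy; exact: lt_le_trans.
have ge0 s : a <= s <= t -> 0 <= s by move=> /andP[as_ _]; exact: le_trans as_.
have m1 r : 0 <= r -> m r Rp = 1%E by have [mP0 _ _] := mp; move=> /mP0 /P0_Rp.
have u0 s : a <= s <= t -> u s = 0.
  pose KZ := (1 + t * normc w) * ((1 + t * normc w) * normc v + `|1 - lambda| * t).
  apply: (@gronwall_backward _ u (fun s => 2 * Z s * Q s (Z s) - G s (Z s)) a t
    (2 * KZ * (2 * y^-2) + 2 * y^-1) a0) => // {}s sat.
    exact: du (ge0 _ sat) (pos _ sat).
  have yZ : apart Rp (Z s) y.
    have zn0 : im (Z s) != 0 by rewrite gt_eqF// pos.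
    split=> // x Rx; apply: le_trans (proj2 (apart_im Rp zn0) x Rx).
    by rewrite gtr0_norm ?pos//; exact: Hy.
  have X1 := normc_Cint_resolvent mRp (m1 _ (ge0 _ sat)) yZ.
  have X2 := normc_Cint_resolvent2 mRp (m1 _ (ge0 _ sat)) yZ.
  apply: (le_trans (ler_normcBD _ _)); apply: lerD => //.
  have n2 : normc (2 : R[i]) = 2.
    by rewrite -(rmorph_nat (real_complex R) 2) normcR gtr0_norm.
  rewrite normcM [normc (2 * _)]normcM n2; apply: ler_pM; rewrite ?mulr_ge0 ?normc_ge0//.
  rewrite ler_wpM2l//. apply: normc_Z; rewrite (ge0 _ sat)/=.
  by case/andP: sat.
move=> s sat; split; first exact: u0.
have [as_ st] := andP sat.
rewrite -[X in im X <= _]Zt.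
apply: (@ler0_derive1_nincr _ (fun x => im (Z x)) a t) => //.
- move=> x; rewrite in_itv/= => /andP[ax xt].
  have x0 : 0 < x by exact: le_lt_trans ax.
  by have [] := is_derive_im x0 (@dZ x).
- move=> x; rewrite in_itv/= => /andP[ax xt].
  have x0 : 0 < x by exact: le_lt_trans ax.
  have xat : a <= x <= t by rewrite !ltW.
  rewrite derive1E; have [_ ->] := is_derive_im x0 (@dZ x).
  have ux : w = p x * G x (Z x) by apply/esym/eqP; rewrite -subr_eq0; apply/eqP/u0.
  (* Where [u x = 0], the explicit speed agrees with the coefficient of the equation, to which
     [im_cauchy_le0] applies. *)
  have -> : l x = 2%:R * (Z x * G x (Z x)) - (1 - lambda)%:C.
    have E1 : (t - x)%:C * w = 1 - p x by rewrite /p subKr.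
    move: E1; set g := G x (Z x) in ux *; rewrite /l /Z rmorphM /= ux => E1.
    have -> : 2%:R * (p x * (p x * v + (1 - lambda)%:C * (t - x)%:C) * g) =
      2%:R * (p x * v * (p x * g) + (1 - lambda)%:C * ((t - x)%:C * (p x * g))).
      by ring.
    by rewrite E1; ring.
  rewrite imD imN imM /= oppr0 addr0 mulrDl mul1r.
  have := im_cauchy_le0 (m1 _ (ltW x0)) (pos _ xat); rewrite -/(G x (Z x)).
  by lra.
- apply/subspace_continuousP => x; rewrite /= in_itv /= => xat.
  have cu := cvg_time_derivative (@dZ x).
  have sub : within `[a, t] (nbhs x) `=>` within Rp (nbhs x).
    move=> P; rewrite /within /=; apply: filterS => z Pz /=; rewrite in_itv/= => /andP[az _].
    by apply: Pz; rewrite in_itv/= (le_trans a0).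
  by apply: (@cvg_im _ _ _ _ Z); apply: cvg_trans cu; exact: cvg_app.
Qed.

Let cont_imZ s : 0 <= s -> forall e : R, 0 < e -> exists2 d : R, 0 < d &
  forall s', 0 <= s' -> `|s' - s| < d -> `|im (Z s') - im (Z s)| < e.
Proof.
move=> s0 e e0.
have /cvg_normcP/(_ _ e0) := cvg_time_derivative (@dZ s).
rewrite /= /within /= => /nbhs_ballP[d /= d0 H]; exists d => // s' s'0 hs.
have : normc (Z s - Z s') < e.
  by apply: H; rewrite /= ?/ball/= 1?distrC// in_itv/= s'0.
by apply: le_lt_trans; rewrite normc_distrC -imN -imD normc_Im.
Qed.

(* Leftwards from [t], consider the last time at which [im (Z s) < im v / 2]. *)
Let im_Z_ge s : 0 <= s <= t -> im v / 2 <= im (Z s).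
Proof.
move=> st; rewrite leNgt; apply/negP => sy.
pose E := [set s : R | 0 <= s <= t /\ im (Z s) < im v / 2].
have Es : E s by split.
have ubE : ubound E t by move=> x [/andP[]].
have hsE : has_sup E by split; [exists s|exists t].
pose s1 := sup E.
have s1t : s1 <= t by apply: ge_sup => //; exists s.
have hub : has_ubound E by exists t.
have ss1 : s <= s1 by exact: ub_le_sup Es.
have s10 : 0 <= s1 by apply: le_trans ss1; case/andP: st.
have above x : s1 < x <= t -> im v / 2 <= im (Z x).
  move=> /andP[sx xt]; rewrite leNgt; apply/negP => xy.
  suff : x <= s1 by rewrite leNgt sx.
  by apply: ub_le_sup => //; split=> //; rewrite xt (le_trans s10) ?ltW.
(* By continuity from the right, as every point of []s1, t]] has height at least [im v / 2]; if
   [s1 = t], because [Z t = v]. *)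
have y1 : im v / 2 <= im (Z s1).
  rewrite leNgt; apply/negP => s1y.
  have e0 : 0 < im v / 2 - im (Z s1) by rewrite subr_gt0.
  have [d d0 H] := cont_imZ s10 e0.
  have [s1t'|] := ltP s1 t; last first.
    move=> ts1; have E1 : s1 = t by apply/eqP; rewrite eq_le s1t ts1.
    have := s1y; rewrite E1 Zt => h; have := v0; lra.
  pose x := Num.min t (s1 + d / 2).
  have d2 : s1 < s1 + d / 2 by rewrite ltrDl divr_gt0.
  have s1x : s1 < x by rewrite lt_min s1t'.
  have xt : x <= t by rewrite ge_min lexx.
  have xd : x <= s1 + d / 2 by rewrite ge_min lexx orbT.
  have hx : `|x - s1| < d by rewrite gtr0_norm ?subr_gt0//; lra.
  have := H x (ltW (le_lt_trans s10 s1x)) hx; rewrite ltr_norml => /andP[_].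
  have := above x; rewrite s1x xt => /(_ isT); lra.
have Hab x : s1 <= x <= t -> im v / 2 <= im (Z x).
  move=> /andP[]; rewrite le_eqVlt => /orP[/eqP <-//|s1x xt].
  by apply: above; rewrite s1x xt.
have sst : s1 <= s1 <= t by rewrite lexx s1t.
(* The height at [s1] improves to [im v], so points of [E] close to [s1] would lie above
   [im v / 2]. *)
have [_ y2] := vanish s10 Hab sst.
have e0 : 0 < im v / 2 by rewrite divr_gt0.
have [d d0 H] := cont_imZ s10 e0.
have [x Ex xd] := sup_adherent d0 hsE; rewrite -/s1 in xd.
have [/andP[x0 xt] xy] := Ex.
have xs1 : x <= s1 by exact: ub_le_sup Ex.
have hx : `|x - s1| < d by rewrite distrC ger0_norm ?subr_ge0//; lra.
have := H x x0 hx; rewrite ltr_norml => /andP[+ _]; lra.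
Qed.

Lemma backward_characteristic : p 0 * G 0 (Z 0) = w /\ im v <= im (Z 0).
Proof.
have Hge x : 0 <= x <= t -> im v / 2 <= im (Z x) by exact: im_Z_ge.
have H0 : 0 <= (0 : R) <= t by rewrite lexx.
have [u0 y0] := vanish (lexx 0) Hge H0.
by split => //; apply/eqP; rewrite -subr_eq0; apply/eqP.
Qed.

End characteristics.

(** * The algebraic relation between [v] and [G_t(v)] in the upper half-plane *)

Section implicit_equation.
Variables (R : realType) (lambda b : R) (m : R -> probability (measurableTypeR R) R).
Local Notation Rp := (`[0, +oo[%classic : set R).
Hypotheses (b_gt0 : 0 < b) (mp : is_m_process lambda m).
Hypothesis m0 : forall A : set (measurableTypeR R), measurable A -> m 0 A = \d_b A.

Lemma cauchy_transform_init z : cauchy_transform (m 0) z = (z - b%:C)^-1.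
Proof.
have mb : measurable ([set b] : set (measurableTypeR R)) by exact: measurable_set1.
have mb1 : m 0 [set b] = 1%E by rewrite m0// diracE mem_set.
have mRp : measurable (Rp : set (measurableTypeR R)) by exact: measurable_itv.
have sub : [set b] `<=` Rp by move=> x -> /=; rewrite in_itv/= ltW.
have [mr mi] := measurable_resolvent z.
rewrite (_ : cauchy_transform _ z = Cint (m 0) Rp (resolvent z))//.
rewrite (Cint_full_subset mb mRp sub mb1); last 2 first.
- exact: measurable_funS mr.
- exact: measurable_funS mi.
rewrite (eq_Cint _ (g := fun=> resolvent z b)); first exact: Cint_cst.
by move=> x ->.
Qed.

(* [cauchy_poly t v w = 0] says that [G 0 (Z 0) = w / p 0], with denominators cleared. *)
Definition cauchy_poly (t : R) (v w : R[i]) : R[i] :=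
  w * (1 - t%:C * w) ^+ 2 * v + ((1 - lambda) * t)%:C * w * (1 - t%:C * w)
  - b%:C * w - (1 - t%:C * w).

Lemma cauchy_poly_upper t v : 0 <= t -> 0 < im v ->
  cauchy_poly t v (cauchy_transform (m t) v) = 0.
Proof.
move=> t0 v0; set w := cauchy_transform _ v.
have [+ +] := backward_characteristic mp t0 v0 (erefl w).
rewrite /cauchy_transform_init subr0 cauchy_transform_init.
set p := 1 - _; set Z := (p * (_ + _)) => H vZ.
(* The curve has not come down by time [0], so it misses the real point [b] and denominators may be
   cleared. *)
have Zb : Z - b%:C != 0.
  rewrite subr_eq0; apply/eqP => E; have := lt_le_trans v0 vZ.
  by rewrite E /= ltxx.
have {}H : p = w * (Z - b%:C) by rewrite -H mulfVK.
by rewrite /cauchy_poly -/p {3}H /Z; ring.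
Qed.

End implicit_equation.

Lemma conjcBR (R : realType) (z : R[i]) (x : R) : (z - x%:C)^* = z^* - x%:C.
Proof. by case: z => a c; apply: eq_ReIm; rewrite /= ?subr0 ?oppr0 ?addr0. Qed.

(** * Extension of the relation to all points off a set of full mass *)

Section cauchy_extension.
Variables (R : realType) (mu : probability (measurableTypeR R) R).
Variable D : set (measurableTypeR R).
Local Notation Rp := (`[0, +oo[%classic : set R).
Hypotheses (mD : measurable D) (D1 : mu D = 1%E) (DRp : D `<=` Rp).

Lemma cauchy_transform_restrict z : cauchy_transform mu z = Cint mu D (resolvent z).
Proof.
have mRp : measurable (Rp : set (measurableTypeR R)) by exact: measurable_itv.
have [mr mi] := measurable_resolvent z.
by apply: (Cint_full_subset mD mRp DRp D1);
  [exact: measurable_funS mr|exact: measurable_funS mi].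
Qed.

Lemma normc_cauchy_transform z e : apart D z e ->
  normc (cauchy_transform mu z) <= 2 * e^-1.
Proof. by move=> zD; rewrite cauchy_transform_restrict; exact: normc_Cint_resolvent zD. Qed.

Lemma normc_cauchy_transformB z z' e e' : apart D z e -> apart D z' e' ->
  normc (cauchy_transform mu z' - cauchy_transform mu z) <=
  2 * (normc (z' - z) / (e' * e)).
Proof.
by move=> zD z'D; rewrite !cauchy_transform_restrict; exact: normc_Cint_resolventB.
Qed.

Lemma cauchy_transform_conj z e : apart D z e ->
  cauchy_transform mu z^* = (cauchy_transform mu z)^*.
Proof.
move=> zD; rewrite !cauchy_transform_restrict /=.
have kJ x : resolvent z^* x = (resolvent z x)^*.
  by rewrite /resolvent -conjcBR conjc_inv.
rewrite /Cint; congr (_ +i* _).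
  by apply: eq_Rintegral => x _; rewrite kJ; case: (resolvent z x).
rewrite -mulN1r -RintegralZl//; last exact: bmeas_Im_integrable mD (bmeas_resolvent mD zD).
by apply: eq_Rintegral => x _; rewrite kJ mulN1r; case: (resolvent z x).
Qed.

End cauchy_extension.

Section implicit_equation_extension.
Variables (R : realType) (lambda b : R) (m : R -> probability (measurableTypeR R) R).
Local Notation Rp := (`[0, +oo[%classic : set R).
Hypotheses (b_gt0 : 0 < b) (mp : is_m_process lambda m).
Hypothesis m0 : forall A : set (measurableTypeR R), measurable A -> m 0 A = \d_b A.
Variables (t : R) (t0 : 0 <= t) (D : set (measurableTypeR R)).
Hypotheses (mD : measurable D) (D1 : m t D = 1%E) (DRp : D `<=` Rp).

(** The coefficients of the polynomial are real. *)
Lemma cauchy_poly_conj (v w : R[i]) :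
  cauchy_poly lambda b t v^* w^* = (cauchy_poly lambda b t v w)^*.
Proof.
have real_conj (x : R) (z : R[i]) : z = x%:C -> z^* = z by move=> ->; exact: conjc_real.
rewrite /cauchy_poly.
move: (t%:C) (((1 - lambda) * t)%:C) (b%:C) (real_conj t _ (erefl _))
  (real_conj ((1 - lambda) * t) _ (erefl _)) (real_conj b _ (erefl _)) => T L B hT hL hB.
by rewrite !(rmorphB, rmorphD, rmorphM, rmorphXn, rmorph1) /= hT hL hB.
Qed.

Lemma cauchy_poly_apart v e : apart D v e ->
  cauchy_poly lambda b t v (cauchy_transform (m t) v) = 0.
Proof.
move=> vD; have [v0|v0|v0] := ltgtP (im v) 0.
- have := cauchy_poly_upper b_gt0 mp m0 t0 (v := v^*).
  rewrite (cauchy_transform_conj mD D1 DRp vD) cauchy_poly_conj => H.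
  apply/eqP; rewrite -conjc_eq0; apply/eqP; apply: H.
  by case: v v0 {vD} => x y /=; rewrite oppr_gt0.
- exact: (cauchy_poly_upper b_gt0 mp m0 t0 v0).
(* For real [v] the relation is obtained at [v + i h] and [h] decreases to [0]. A vertical shift
   does not bring [v] closer to real points, so the same [e] serves for all [h] and makes the Cauchy
   transform continuous along the shift. *)
have e0 : 0 < e by case: vD.
pose vh (h : R) : R[i] := v + (0 +i* h).
have hD h : apart D (vh h) e.
  split=> // x Dx; apply: le_trans (proj2 vD x Dx) _.
  have -> : normc (v - x%:C) = `|re (v - x%:C)|.
    case: v v0 {vD vh} => a c /= ->.
    by rewrite subr0 expr0n /= addr0 sqrtr_sqr.
  apply: le_trans (normc_Re _); rewrite /vh.
  by case: v v0 {vD vh} => a c /= _; rewrite addr0.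
have cvh : (vh : R -> R[i]^o) @ 0^'+ --> (v : R[i]^o).
  apply/cvg_normcP => eps eps0.
  apply: filterS2 (nbhs_right_gt 0) (nbhs_right_lt eps0) => h h0 he.
  by rewrite /vh opprD addrA subrr sub0r normcN /= expr0n/= add0r sqrtr_sqr gtr0_norm.
pose g h := cauchy_transform (m t) (vh h).
have cg : (g : R -> R[i]^o) @ 0^'+ --> (cauchy_transform (m t) v : R[i]^o).
  apply/cvg_normcP => eps eps0.
  have /cvg_normcP/(_ (eps * (e * e) / 2)) := cvh.
  rewrite !divr_gt0 ?mulr_gt0// => /(_ isT); apply: filterS => h hh.
  apply: le_lt_trans (normc_cauchy_transformB mD D1 DRp (hD h) vD) _.
  by rewrite mulrA ltr_pdivrMr ?mulr_gt0// mulrC -ltr_pdivlMr.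
have cF : ((fun h => cauchy_poly lambda b t (vh h) (g h)) : R -> R[i]^o) @ 0^'+ -->
    (cauchy_poly lambda b t v (cauchy_transform (m t) v) : R[i]^o).
  have cp : ((fun h => 1 - t%:C * g h) : R -> R[i]^o) @ 0^'+ -->
      (1 - t%:C * cauchy_transform (m t) v : R[i]^o).
    by apply: cvgcB; [exact: cvg_cst|apply: cvgcM; [exact: cvg_cst|exact: cg]].
  rewrite /cauchy_poly; apply: cvgcB; last exact: cp.
  apply: cvgcB; last by apply: cvgcM; [exact: cvg_cst|exact: cg].
  apply: cvgcD; last first.
    by apply: cvgcM; last exact: cp; apply: cvgcM; [exact: cvg_cst|exact: cg].
  by apply: cvgcM; last exact: cvh; apply: cvgcM; [exact: cg|exact: cvgcM].
have cF0 : ((fun h => cauchy_poly lambda b t (vh h) (g h)) : R -> R[i]^o) @ 0^'+ -->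
    (0 : R[i]^o).
  apply/cvg_normcP => eps eps0; apply: filterS (nbhs_right_gt 0) => h h0.
  rewrite (cauchy_poly_upper b_gt0 mp m0 t0) ?subrr ?normc0//.
  by rewrite /vh imD v0 add0r.
exact: (cvg_unique (@norm_hausdorff R[i] R[i]^o) cF cF0).
Qed.

End implicit_equation_extension.

(** * The R-transform *)

Section explicit_inverse.
Variables (R : realType) (lambda b t : R).
Hypotheses (lambda_ge0 : 0 <= lambda) (b_gt0 : 0 < b) (t_ge0 : 0 <= t).
Implicit Types w z : R[i].

(** [cauchy_poly] is affine in [v]; with [q = 1 - t w], this is its root, after writing [1 / (w q)]
    as [1 / w + t / q]. *)
Definition explicit_inverse w : R[i] :=
  w^-1 + b%:C * (1 - t%:C * w)^-1 ^+ 2 + (lambda * t)%:C * (1 - t%:C * w)^-1.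

Lemma cauchy_poly_explicit_inverse v w : 1 - t%:C * w != 0 ->
  cauchy_poly lambda b t v w = 0 -> w != 0 /\ explicit_inverse w = v.
Proof.
move=> q0; rewrite /cauchy_poly => H.
(* At [w = 0] the polynomial takes the value [- 1]. *)
have w0 : w != 0.
  apply/eqP => w0; move: H; rewrite w0 !(mulr0, mul0r) !add0r subr0 => /eqP.
  by rewrite oppr0 add0r oppr_eq0 oner_eq0.
split=> //; apply: (@mulfI _ (w * (1 - t%:C * w) ^+ 2)).
  by rewrite mulf_neq0 ?expf_neq0.
apply/eqP; rewrite -subr_eq0; apply/eqP; rewrite -[RHS]oppr0 -H /explicit_inverse.
by rewrite mulrBl; field; rewrite q0 w0.
Qed.

Lemma R_formulaE w : w != 0 -> 1 - t%:C * w != 0 ->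
  w * explicit_inverse w - 1 = R_formula lambda b t w.
Proof.
move=> w0 q0; rewrite /explicit_inverse /R_formula.
by field; rewrite w0 q0.
Qed.

(** [eps] is small enough that [normc w <= eps] gives [normc (t w) <= 1 / 2], hence [1 / (1 - t w)]
    has modulus at most [2]; [L] is the bound this yields for the factor [c] in the injectivity
    proof, and [eps * L < 1]. *)
Let L := 4 * t * (4 * b + lambda * t).
Let eps := (2 * (t + 1) + L)^-1.

Let L_ge0 : 0 <= L.
Proof. by rewrite !mulr_ge0// addr_ge0// ?mulr_ge0// ltW. Qed.

Let eps_gt0 : 0 < eps.
Proof. by rewrite invr_gt0 ltr_pwDl// mulr_gt0// ltr_wpDl. Qed.

Let eps_den : 0 < 2 * (t + 1) + L.
Proof. by rewrite ltr_pwDl// mulr_gt0// ltr_wpDl. Qed.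

Let t_eps : t * eps <= 1 / 2.
Proof. by rewrite ler_pdivrMr//; have := L_ge0; lra. Qed.

Let eps2 : eps <= 1 / 2.
Proof.
by rewrite /eps -div1r ler_pdivrMr//; have := L_ge0; have := t_ge0; lra.
Qed.

Let eps_L : eps * L < 1.
Proof. by rewrite mulrC ltr_pdivrMr// mul1r ltrDr mulr_gt0// ltr_wpDl. Qed.

Let normc_q w : normc w <= eps -> 1 / 2 <= normc (1 - t%:C * w).
Proof.
move=> we; have := ler_normcB 1 (t%:C * w); rewrite normc1 normcM normcR ger0_norm//.
have := ler_wpM2l t_ge0 we; have := t_eps; lra.
Qed.

Let q_neq0 w : normc w <= eps -> 1 - t%:C * w != 0.
Proof. by move=> /normc_q H; rewrite -normc_gt0; apply: lt_le_trans H; rewrite divr_gt0. Qed.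

Let normc_qV w : normc w <= eps -> normc (1 - t%:C * w)^-1 <= 2.
Proof.
move=> we; rewrite normcV -[leRHS]invrK lef_pV2 ?posrE ?invr_gt0//.
  by rewrite -div1r normc_q.
by rewrite normc_gt0 q_neq0.
Qed.

(** The difference of two values, times [w w'], factors as [(w' - w) (1 - w w' c)], and [w w' c] has
    modulus below [1] near [0]. *)
Lemma explicit_inverse_inj : exists2 e : R, 0 < e &
  (forall w, normc w <= e -> 1 - t%:C * w != 0) /\
  forall w w', w != 0 -> w' != 0 -> normc w <= e -> normc w' <= e ->
    explicit_inverse w = explicit_inverse w' -> w = w'.
Proof.
exists eps => //; split; first exact: q_neq0.
move=> w w' w0 w'0 we w'e H.
have q0 := q_neq0 we; have q'0 := q_neq0 w'e.
pose q := (1 - t%:C * w)^-1; pose q' := (1 - t%:C * w')^-1.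
pose c := t%:C * q * q' * (b%:C * (q + q') + (lambda * t)%:C).
have E : (w' - w) * (1 - w * w' * c) = w * w' * (explicit_inverse w - explicit_inverse w').
  rewrite /c /q /q' /explicit_inverse !rmorphM /=; field.
  by rewrite w0 w'0 q0 q'0.
move: E; rewrite H subrr mulr0 => /eqP; rewrite mulf_eq0 => /orP[|].
  by rewrite subr_eq0 => /eqP.
rewrite subr_eq0 => /eqP /(congr1 (@normc R)); rewrite normc1 => E; exfalso.
have nc : normc c <= L.
  have n4 : L = t * 2 * 2 * (b * (2 + 2) + lambda * t) by rewrite /L; ring.
  rewrite n4 /c !normcM normcR (ger0_norm t_ge0).
  apply: ler_pM; rewrite ?mulr_ge0 ?normc_ge0//.
    by apply: ler_pM; rewrite ?mulr_ge0 ?normc_ge0 ?normc_qV// ler_wpM2l ?normc_qV.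
  apply: (le_trans (le_normcD _ _)); apply: lerD.
    rewrite normcM normcR (gtr0_norm b_gt0) ler_pM2l//.
    by apply: (le_trans (le_normcD _ _)); apply: lerD; exact: normc_qV.
  by rewrite normcR ger0_norm ?mulr_ge0.
suff : normc (w * w' * c) < 1 by rewrite -E ltxx.
rewrite normcM normcM; apply: le_lt_trans eps_L.
apply: ler_pM; rewrite ?mulr_ge0 ?normc_ge0//.
rewrite -[eps]mulr1; apply: ler_pM; rewrite ?normc_ge0//.
by apply: (le_trans w'e); have := eps2; lra.
Qed.

(** Near [0] the term [1 / w] dominates, the other two being bounded by [4 b] and [2 lambda t]; [r']
    leaves room for both. *)
Lemma explicit_inverse_large (r : R) : exists2 d : R, 0 < d &
  forall w, w != 0 -> normc w < d -> 1 - t%:C * w != 0 /\ r < normc (explicit_inverse w).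
Proof.
pose r' := Num.max r 0 + 4 * b + 2 * (lambda * t) + 1.
have r'0 : 0 < r'.
  rewrite /r' ltr_wpDl// !addr_ge0 ?mulr_ge0// ?le_max ?lexx ?orbT//; exact: ltW.
exists (Num.min eps r'^-1); first by rewrite lt_min eps_gt0 invr_gt0.
move=> w w0; rewrite lt_min => /andP[/ltW we wr]; split; first exact: q_neq0.
have wr' : r' < (normc w)^-1.
  by rewrite -[ltLHS]invrK ltf_pV2 ?posrE ?invr_gt0// normc_gt0.
have X := normc_qV we.
have B1 : normc (b%:C * (1 - t%:C * w)^-1 ^+ 2) <= 4 * b.
  rewrite normcM normcX normcR (gtr0_norm b_gt0) mulrC ler_wpM2r//; first exact: ltW.
  have -> : 4 = 2 ^+ 2 :> R by rewrite -natrX.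
  by rewrite lerXn2r ?nnegrE ?normc_ge0.
have B2 : normc ((lambda * t)%:C * (1 - t%:C * w)^-1) <= 2 * (lambda * t).
  by rewrite normcM normcR ger0_norm ?mulr_ge0// mulrC ler_wpM2r ?mulr_ge0.
have := ler_normcB w^-1
  (- (b%:C * (1 - t%:C * w)^-1 ^+ 2 + (lambda * t)%:C * (1 - t%:C * w)^-1)).
rewrite opprK addrA -/(explicit_inverse w) normcV normcN.
have := le_normcD (b%:C * (1 - t%:C * w)^-1 ^+ 2) ((lambda * t)%:C * (1 - t%:C * w)^-1).
have : r <= Num.max r 0 by rewrite le_max lexx.
by move: wr'; rewrite /r'; lra.
Qed.

End explicit_inverse.

Section R_transform_formula.
Variables (R : realType) (lambda b : R) (m : R -> probability (measurableTypeR R) R).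
Hypotheses (lambda_ge0 : 0 <= lambda) (b_gt0 : 0 < b) (mp : is_m_process lambda m).
Hypothesis m0 : forall A : set (measurableTypeR R), measurable A -> m 0 A = \d_b A.
Variables (t : R) (t0 : 0 <= t).

Let K := explicit_inverse lambda b t.

(** The support lies in some [[0, M]], at distance at least [normc v - M] from [v]. *)
Lemma cauchy_transform_large : exists M : R, forall v, M < normc v ->
  normc (cauchy_transform (m t) v) <= 2 * (normc v - M)^-1 /\
  cauchy_poly lambda b t v (cauchy_transform (m t) v) = 0.
Proof.
have [mP0 _ _] := mp; have [M M1] := mP0 t t0.
have mD : measurable (`[0, M]%classic : set (measurableTypeR R)) by exact: measurable_itv.
have DRp : `[0, M]%classic `<=` (`[0, +oo[%classic : set R).
  by move=> x /=; rewrite !in_itv/= => /andP[->].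
exists M => v Mv.
have vD : apart `[0, M]%classic v (normc v - M).
  split; first by rewrite subr_gt0.
  move=> x /=; rewrite in_itv/= => /andP[x0 xM].
  apply: le_trans (ler_normcB _ _); rewrite normcR ger0_norm//; lra.
split; first exact: (normc_cauchy_transform mD M1 DRp vD).
exact: (cauchy_poly_apart b_gt0 mp m0 t0 mD M1 DRp vD).
Qed.

(** For large [v] the value [G v] is small and the relation gives [K (G v) = v]. For small [w] the
    point [K w] is large, so [K (G (K w)) = K w], and injectivity of [K] near [0] gives
    [G (K w) = w]. *)
Lemma explicit_inverse_spec : cauchy_inverse_spec (m t) K.
Proof.
have [M HM] := cauchy_transform_large.
have [e e0 [q0 Kinj]] := explicit_inverse_inj lambda_ge0 b_gt0 t0.
have small v : `|M| + 2 / e < normc v -> normc (cauchy_transform (m t) v) <= e.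
  move=> vM; have e20 : 0 < 2 / e by rewrite divr_gt0.
  have hM : M < normc v by have := ler_norm M; lra.
  apply: (le_trans (proj1 (HM v hM))); rewrite ler_pdivrMr ?subr_gt0//.
  by rewrite mulrC -ler_pdivrMr//; have := ler_norm M; lra.
have large v : `|M| + 2 / e < normc v -> cauchy_transform (m t) v != 0 /\
    K (cauchy_transform (m t) v) = v.
  move=> vM; apply: cauchy_poly_explicit_inverse; first exact/q0/small.
  have e20 : 0 < 2 / e by rewrite divr_gt0.
  by apply: (proj2 (HM v _)); have := ler_norm M; lra.
split; first by exists (`|M| + 2 / e) => v; rewrite normc_normr ltcR => /large[].
have [d d0 Hd] := explicit_inverse_large lambda_ge0 b_gt0 t0 (`|M| + 2 / e).
apply/nbhs0_normcP; exists (Num.min d e); first by rewrite lt_min d0 e0.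
move=> w w0; rewrite lt_min => /andP[wd we].
have [_ Kw] := Hd w w0 wd; have [Gw0 KG] := large _ Kw.
by apply: Kinj => //; [exact: small|exact: ltW].
Qed.

(** Needed because [cauchy_inverse] is chosen by [xget]. Near [0] one has [w = G (K w)] with [K w]
    large, where [K'] undoes [G]. *)
Lemma cauchy_inverse_unique K' : cauchy_inverse_spec (m t) K' ->
  \forall w \near (0 : R[i]^o)^', K' w = K w.
Proof.
move=> [[r Kr] _]; have [_ /nbhs0_normcP[d1 d10 GK]] := explicit_inverse_spec.
have [d2 d20 Hd] := explicit_inverse_large lambda_ge0 b_gt0 t0 r.
apply/nbhs0_normcP; exists (Num.min d1 d2); first by rewrite lt_min d10 d20.
move=> w w0; rewrite lt_min => /andP[w1 w2].
have [_ Kw] := Hd w w0 w2.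
by rewrite -{1}(GK w w0 w1) Kr// normc_normr ltcR.
Qed.

Lemma R_transformE : \forall z \near (0 : R[i]^o)^',
  R_transform (m t) z = R_formula lambda b t z.
Proof.
have Hs : cauchy_inverse_spec (m t) (cauchy_inverse (m t)).
  by apply: (@xgetPex _ (fun=> 0)); exists K; exact: explicit_inverse_spec.
have /nbhs0_normcP[d1 d10 H1] := cauchy_inverse_unique Hs.
have [d2 d20 H2] := explicit_inverse_large lambda_ge0 b_gt0 t0 0.
apply/nbhs0_normcP; exists (Num.min d1 d2); first by rewrite lt_min d10 d20.
move=> w w0; rewrite lt_min => /andP[w1 w2].
have [q0 _] := H2 w w0 w2.
by rewrite /R_transform H1// R_formulaE.
Qed.

(** If all the mass were at [0], then [G (-1) = -1], and the relation at [v = -1] would read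
    [b + lambda t (1 + t) = 0]. *)
Lemma mass0_lt1 : (m t [set 0%R : R] < 1)%E.
Proof.
have ms : measurable ([set 0] : set (measurableTypeR R)) by exact: measurable_set1.
rewrite lt_neqAle probability_le1// andbT; apply/eqP => M1.
have DRp : [set 0] `<=` (`[0, +oo[%classic : set R).
  by move=> x ->; rewrite /= in_itv/= lexx.
have vD : apart [set 0] (- 1 : R[i]) 1.
  by split=> // x ->; rewrite subr0 normcN normc1.
have := cauchy_poly_apart b_gt0 mp m0 t0 ms M1 DRp vD.
rewrite (cauchy_transform_restrict ms M1 DRp).
rewrite (eq_Cint _ (g := fun=> -1)); last first.
  by move=> x ->; rewrite /resolvent subr0 invrN invr1.
rewrite Cint_cst// (_ : cauchy_poly _ _ _ _ _ = (b + lambda * t * (1 + t))%:C); last first.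
  by rewrite /cauchy_poly !(rmorphD, rmorphM, rmorphB, rmorph1)/=; ring.
by move/complexI/eqP; rewrite gt_eqF// ltr_pwDl// mulr_ge0 ?mulr_ge0// addr_ge0.
Qed.

End R_transform_formula.

(** * The S-transform *)

Section left_half_plane_integrals.
Variables (R : realType) (mu : probability (measurableTypeR R) R).
Local Notation Rp := (`[0, +oo[%classic : set R).
Hypotheses (mu1 : mu Rp = 1%E) (mu0 : (mu [set 0%R : R] < 1)%E).
Implicit Types (u v z : R[i]).

Lemma left_half_planeP u : left_half_plane u <-> re u < 0.
Proof.
split=> [[w /= w0 <-]|u0]; first by rewrite reM /= mul0r mul1r sub0r oppr_lt0.
exists (im u +i* - re u); first by rewrite /= oppr_gt0.
by apply: eq_ReIm; rewrite ?reM ?imM /= ?mul0r ?mul1r ?sub0r ?add0r ?addr0 ?opprK.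
Qed.

Let mRp : measurable (Rp : set (measurableTypeR R)).
Proof. exact: measurable_itv. Qed.

Lemma re_lt0_neq0 v : re v < 0 -> v != 0.
Proof. by move=> v0; apply/eqP => E; move: v0; rewrite E ltxx. Qed.

(** From the left half-plane the nearest point of [[0, +oo[] is [0]. *)
Lemma apart_left v : re v < 0 -> apart Rp v (normc v).
Proof.
move=> v0; split; first by rewrite normc_gt0 re_lt0_neq0.
move=> x /=; rewrite in_itv/= andbT => x0.
rewrite -(ler_sqr (normc_ge0 _)) ?nnegrE ?normc_ge0// !sqr_normcE.
rewrite reD imD reN imN /= oppr0 addr0 lerD2r.
rewrite -subr_ge0 [X in 0 <= X](_ : _ = x * (x - 2 * re v)); last by ring.
by rewrite mulr_ge0//; lra.
Qed.

(** With [v = 1 / u], again in the left half-plane, the integrand of [Psi] is [v / (v - x) - 1]. *)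
Lemma PsiE u : re u < 0 -> Psi mu u = u^-1 * cauchy_transform mu u^-1 - 1.
Proof.
move=> u0; have un0 := re_lt0_neq0 u0.
have v0 : re u^-1 < 0.
  by rewrite reV pmulr_llt0// invr_gt0 exprn_gt0// normc_gt0.
have vD := apart_left v0; have bk := bmeas_resolvent mRp vD.
rewrite (_ : cauchy_transform mu _ = Cint mu Rp (resolvent u^-1))//.
rewrite -CintZ// -[X in _ - X](Cint_cst 1 mRp mu1) -CintB//; last 2 first.
- by apply: bmeasM => //; exact: bmeas_cst.
- exact: bmeas_cst.
apply: eq_Cint => x Rx; have := apart_neq0 vD Rx; rewrite /resolvent => q0.
have q1 : 1 - x%:C * u != 0.
  by apply: contra q0 => /eqP/subr0_eq E; rewrite -(mulfK un0 x%:C) -E mul1r subrr.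
by field; rewrite un0 mulNr; exact: q1.
Qed.

(** A zero integral would force [g = 0] almost everywhere, so []0, +oo[] would be null and all the
    mass would sit at [0]. *)
Lemma Rintegral_pos (g : measurableTypeR R -> R) :
  mu.-integrable Rp (EFin \o g) -> (forall x, 0 <= x -> 0 <= g x) ->
  (forall x, 0 < x -> 0 < g x) -> 0 < \int[mu]_(x in Rp) g x.
Proof.
move=> ig g0 gp.
have g0' x : Rp x -> 0 <= g x by rewrite /= in_itv/= andbT => /g0.
rewrite lt0r Rintegral_ge0// andbT; apply/eqP => I0.
have If : (\int[mu]_(x in Rp) (g x)%:E)%E = 0%E.
  by rewrite -[LHS]fineK ?(integrable_fin_num mRp ig)//; congr EFin.
have mg : measurable_fun Rp (EFin \o g) by apply: measurable_int ig.
have /(ae_eq_integral_abs mu mRp mg)[N [mN N0 HN]] :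
    (\int[mu]_(x in Rp) `|(EFin \o g) x|)%E = 0%E.
  rewrite -[RHS]If; apply: eq_integral => x /set_mem Rx /=.
  by rewrite ger0_norm// g0'.
have ms : measurable ([set 0] : set (measurableTypeR R)) by exact: measurable_set1.
have mRD : measurable (Rp `\` [set 0] : set (measurableTypeR R)) by exact: measurableD.
have sub : Rp `\` [set 0] `<=` N.
  move=> x [Rx /= x0]; apply: HN => /= /(_ Rx) [gx0].
  have x_gt0 : 0 < x.
    rewrite lt0r; move: Rx; rewrite /= in_itv/= andbT => ->; rewrite andbT.
    exact/eqP.
  by have := gp _ x_gt0; rewrite gx0 ltxx.
have D0 : mu (Rp `\` [set 0]) = 0%E.
  by apply/eqP; rewrite -measure_le0 -N0; apply: le_measure; rewrite ?inE.
move: mu0; rewrite (_ : mu [set 0] = 1%E) ?ltxx// -mu1.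
have -> : Rp = (Rp `\` [set 0]) `|` [set 0].
  by rewrite setUC setDUK// => x ->; rewrite /= in_itv/= lexx.
transitivity (mu (Rp `\` [set 0%R]) + mu [set 0%R])%E; first by rewrite D0 add0e.
apply/esym/measureU => //.
by apply/seteqP; split => // x [[_ h] h2]; case: (h h2).
Qed.

Lemma re_cauchy_le0 v : re v < 0 -> re (cauchy_transform mu v) <= 0.
Proof.
move=> v0; have bk := bmeas_resolvent mRp (apart_left v0).
apply: (@le_trans _ _ (\int[mu]_(x in Rp) 0)%R); last first.
  by rewrite (Rintegral_probability_cst 0 mRp mu1).
apply: le_Rintegral => //.
- exact: (bmeas_Re_integrable _ mRp bk).
- by apply: (bmeas_Re_integrable _ mRp (bmeas_cst _ 0)).
move=> x; rewrite /= in_itv/= andbT => x0.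
rewrite /resolvent reV reD reN /= pmulr_lle0; first lra.
rewrite invr_gt0 exprn_gt0// normc_gt0 (apart_neq0 (apart_left v0))//.
by rewrite /= in_itv/= x0.
Qed.

(** This is [Psi mu (1 / v)], the integral of [x / (v - x)]. *)
Let I v := v * cauchy_transform mu v - 1.

Let IE v : re v < 0 -> bmeas Rp (fun x => v * resolvent v x - 1) /\
  I v = Cint mu Rp (fun x => v * resolvent v x - 1).
Proof.
move=> v0; have vD := apart_left v0; have bk := bmeas_resolvent mRp vD.
have bc c : bmeas Rp (fun _ : measurableTypeR R => c : R[i]) by exact: bmeas_cst.
have bM : bmeas Rp (fun x => v * resolvent v x) by apply: bmeasM.
split; first by apply: bmeasD => //; exact: bc.
by rewrite CintB ?CintZ ?Cint_cst//; exact: bc.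
Qed.

Let resolventE v x : re v < 0 -> 0 <= x -> v * resolvent v x - 1 = x%:C * resolvent v x.
Proof.
move=> v0 x0; have Rx : Rp x by rewrite /= in_itv/= x0.
by have := apart_neq0 (apart_left v0) Rx; rewrite /resolvent => q0; field.
Qed.

(** [- im v] times the imaginary part of [x / (v - x)] is [(im v)^2 x / |v - x|^2], positive for
    [x > 0]. *)
Lemma im_moment_neq0 v : re v < 0 -> im v != 0 -> im (I v) != 0.
Proof.
move=> v0 iv0; have [bf ->] := IE v0.
have bi := bmeas_Im_integrable mu mRp bf.
suff : 0 < - im v * im (Cint mu Rp (fun x => v * resolvent v x - 1)).
  by apply: contraTneq => ->; rewrite mulr0 ltxx.
have E x : 0 <= x -> - im v * im (v * resolvent v x - 1) = im v ^+ 2 * (x / normc (v - x%:C) ^+ 2).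
  move=> x0; rewrite resolventE// imM /resolvent imV imD imN /= mul0r addr0 oppr0 addr0; ring.
have n0 x : 0 <= x -> 0 < normc (v - x%:C) ^+ 2.
  move=> x0; rewrite exprn_gt0// normc_gt0 (apart_neq0 (apart_left v0))//.
  by rewrite /= in_itv/= x0.
rewrite /= -RintegralZl//; apply: Rintegral_pos.
- exact: integrableZlR.
- move=> x x0; rewrite E// mulr_ge0 ?sqr_ge0// divr_ge0//.
  exact/ltW/n0.
- move=> x x0; rewrite E ?ltW// mulr_gt0 ?exprn_even_gt0// divr_gt0//.
  exact/n0/ltW.
Qed.

(** The difference of the integrands is [x (c - a) / ((a - x) (c - x))], positive for [x > 0]. *)
Lemma re_moment_decr (a c : R) : a < c -> c < 0 -> re (I c%:C) < re (I a%:C).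
Proof.
move=> ac c0; have a0 : a < 0 by exact: lt_trans c0.
have [bc ->] := @IE c%:C c0; have [ba ->] := @IE a%:C a0.
have ic := bmeas_Re_integrable mu mRp bc.
have ia := bmeas_Re_integrable mu mRp ba.
rewrite -subr_gt0 /= -RintegralB//.
have E (d x : R) : d < 0 -> 0 <= x -> re (d%:C * resolvent d%:C x - 1) = x / (d - x).
  by move=> d0 x0; rewrite resolventE// /resolvent -rmorphB -fmorphV -rmorphM.
have P x : 0 <= x -> re (a%:C * resolvent a%:C x - 1) - re (c%:C * resolvent c%:C x - 1) =
    x * ((c - a) / ((a - x) * (c - x))).
  move=> x0; rewrite !E//; field; rewrite !lt_eqF//; lra.
have Q x : 0 <= x -> 0 < (c - a) / ((a - x) * (c - x)).
  by move=> x0; rewrite divr_gt0 ?subr_gt0// nmulr_rgt0; lra.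
apply: Rintegral_pos.
- exact: (integrableB mRp ia ic).
- by move=> x x0; rewrite P// mulr_ge0// ltW// Q.
- by move=> x x0; rewrite P ?ltW// mulr_gt0// Q// ltW.
Qed.

End left_half_plane_integrals.

Lemma re_realM (R : realType) (a : R) (z : R[i]) : re (a%:C * z) = a * re z.
Proof. by rewrite reM /= mul0r subr0. Qed.

(** * The principal square root *)

Section square_root.
Variable R : realType.
Implicit Types x y : R[i].

Lemma re_sqrtc_ge0 y : 0 <= re (sqrtc y).
Proof. by case: y => a c; exact: sqrtr_ge0. Qed.

Lemma sqrtc_sqr x : 0 < re x -> sqrtc (x ^+ 2) = x.
Proof.
move=> x0; have /eqP := sqr_sqrtc (x ^+ 2); rewrite eqf_sqr => /orP[/eqP//|/eqP E].
by have := re_sqrtc_ge0 (x ^+ 2); rewrite E reN oppr_ge0 leNgt x0.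
Qed.

(** Factor [1 - y] as a difference of squares; [1 + sqrtc y] has real part at least [1]. This gives
    continuity of the root at [1]. *)
Lemma normc_sqrtc_sub1 y : normc (1 - sqrtc y) <= normc (1 - y).
Proof.
have -> : normc (1 - y) = normc (1 - sqrtc y) * normc (1 + sqrtc y).
  by rewrite -normcM -subr_sqr expr1n sqr_sqrtc.
rewrite ler_peMr ?normc_ge0//; apply: le_trans (normc_Re _).
apply: le_trans (ler_norm _); rewrite reD /= lerDl; exact: re_sqrtc_ge0.
Qed.

End square_root.

(** * Selecting the branch of the square root on the left half-plane *)

Section S_transform_formula.
Variables (R : realType) (lambda b : R) (m : R -> probability (measurableTypeR R) R).
Local Notation Rp := (`[0, +oo[%classic : set R).
Hypotheses (lambda_ge0 : 0 <= lambda) (b_gt0 : 0 < b) (mp : is_m_process lambda m).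
Hypothesis m0 : forall A : set (measurableTypeR R), measurable A -> m 0 A = \d_b A.
Variables (t : R) (t0 : 0 <= t).
Implicit Types (u v z : R[i]).

Let G v := cauchy_transform (m t) v.
Let mRp : measurable (Rp : set (measurableTypeR R)).
Proof. exact: measurable_itv. Qed.
Let m1 : m t Rp = 1%E.
Proof. by have [mP0 _ _] := mp; exact/P0_Rp/mP0. Qed.
Let mass0 : (m t [set 0%R : R] < 1)%E := mass0_lt1 lambda_ge0 b_gt0 mp m0 t0.

Let q_neq0 v : re v < 0 -> 1 <= re (1 - t%:C * G v) /\ 1 - t%:C * G v != 0.
Proof.
move=> v0; have w0 := re_cauchy_le0 m1 v0.
have H : 1 <= re (1 - t%:C * G v).
  rewrite reD reN reM /= mul0r subr0 lerDl oppr_ge0.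
  by rewrite mulr_ge0_le0.
by split=> //; apply/eqP => E; move: H; rewrite E /= ler10.
Qed.

Let GE v : re v < 0 -> G v != 0 /\ explicit_inverse lambda b t (G v) = v.
Proof.
move=> v0; apply: cauchy_poly_explicit_inverse; first by have [] := q_neq0 v0.
exact: (cauchy_poly_apart b_gt0 mp m0 t0 mRp m1 (@subset_refl _ _) (apart_left v0)).
Qed.

(* The square root of [(lambda t + b)^2 + 4 b t z] selected by the process, where
   [z = v G(v) - 1]; rational in [G v] because the curve is rational. *)
Let disc v : R[i] :=
  (lambda * t)%:C + b%:C * ((1 + t%:C * G v) / (1 - t%:C * G v)).

Let disc_sqr v : re v < 0 -> disc v ^+ 2 =
  ((lambda * t + b) ^+ 2)%:C + (4 * b * t)%:C * (v * G v - 1).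
Proof.
move=> v0; have [w0 {2}<-] := GE v0; have [_ q0] := q_neq0 v0.
by rewrite /disc /explicit_inverse; field; rewrite w0 q0.
Qed.

(** The numerator of [re (disc v)]: it has the same sign and is continuous without discussing a
    quotient. *)
Let Fdisc v : R := lambda * t * normc (1 - t%:C * G v) ^+ 2 +
  b * (1 - t ^+ 2 * normc (G v) ^+ 2).

Let re_disc v : re v < 0 -> re (disc v) = Fdisc v / normc (1 - t%:C * G v) ^+ 2.
Proof.
move=> v0; have [_ q0] := q_neq0 v0.
have n0 : normc (1 - t%:C * G v) ^+ 2 != 0 by rewrite expf_neq0// normc_eq0.
rewrite /Fdisc mulrDl mulfK// /disc reD; congr (_ + _).
rewrite reM [re _%:C]/= [im _%:C]/= mul0r subr0 -mulrA; congr (b * _).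
rewrite reM reV imV !mulNr mulrN opprK !mulrA -mulrDl; congr (_ / _).
rewrite -mulrA -expr2 sqr_normcE !(reD, imD, reN, imN, reM, imM) /=; ring.
Qed.

(* Off the real line [z] is not real; on the negative axis [disc] is real and [z] is
   strictly decreasing, so [disc] cannot vanish without [disc ^+ 2] becoming negative. *)
Let re_disc_neq0 v : 0 < t -> re v < 0 -> re (disc v) != 0.
Proof.
move=> tp v0; apply/eqP => re0.
have D2 := disc_sqr v0.
have bt : 0 < 4 * b * t by rewrite !mulr_gt0.
have [iv0|iv0] := eqVneq (im v) 0; last first.
  have /eqP := im_moment_neq0 m1 mass0 v0 iv0; apply.
  move: D2 => /(congr1 (@complex.Im R)).
  rewrite expr2 imM re0 mul0r mulr0 addr0 imD imM /= mul0r addr0 add0r => /esym/eqP.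
  by rewrite mulf_eq0 gt_eqF//= => /eqP.
have vR : v = (re v)%:C by apply: eq_ReIm.
(* By conjugation symmetry [G] is real on the negative axis. *)
have real_disc (a : R) : a < 0 -> im (disc a%:C) = 0.
  move=> a0; have wJ := cauchy_transform_conj mRp m1 (@subset_refl _ _) (@apart_left _ a%:C a0).
  rewrite conjc_real in wJ.
  have wR : G a%:C = (re (G a%:C))%:C.
    rewrite /G; move: wJ; case: (cauchy_transform _ _) => x y [yy].
    by apply: eq_ReIm => //=; lra.
  rewrite /disc wR; set x := re _.
  suff -> : (lambda * t)%:C + b%:C * ((1 + t%:C * x%:C) / (1 - t%:C * x%:C)) =
    (lambda * t + b * ((1 + t * x) / (1 - t * x)))%:C by [].
  rewrite [RHS]rmorphD; congr (_ + _); rewrite [RHS]rmorphM; congr (_ * _).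
  by rewrite [RHS]rmorphM fmorphV rmorphD rmorphB rmorphM rmorph1.
have dv0 : disc v = 0 by apply: eq_ReIm => //; rewrite vR real_disc.
pose a := re v / 2.
have a0 : a < 0 by rewrite pmulr_llt0.
have va : re v < a by rewrite /a; lra.
have := re_moment_decr m1 mass0 va a0; rewrite -vR => decr.
have := disc_sqr (v := a%:C) a0; have := real_disc a a0.
move: (disc a%:C) => d id /(congr1 (@complex.Re R)).
rewrite expr2 reM id mul0r subr0 -expr2 reD re_realM => E2.
move: D2; rewrite dv0 expr0n => /(congr1 (@complex.Re R)).
rewrite reD re_realM => E1.
have := sqr_ge0 (re d); rewrite E2.
move: decr; rewrite -(ltr_pM2l bt) -/(G a%:C) -/(G v).
set X := _ * re _; set Y := _ * re _ in E1 *.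
by move: E1 => /= E1 h1 h2; lra.
Qed.

(* Intermediate value theorem along the ray [r v], [r >= 1], on which [disc] tends to
   [lambda t + b] at infinity. *)
Lemma re_disc_gt0 v : 0 < t -> re v < 0 -> 0 < re (disc v).
Proof.
move=> tp v0; rewrite ltNge; apply/negP => dle0.
have vn0 := re_lt0_neq0 v0; have nv : 0 < normc v by rewrite normc_gt0.
have rv0 (r : R) : 1 <= r -> re (r%:C * v) < 0.
  by move=> r1; rewrite reM /= mul0r subr0 pmulr_rlt0//; lra.
have apart_r (r : R) : 1 <= r -> apart Rp (r%:C * v) (r * normc v).
  move=> r1; have := apart_left (rv0 r r1).
  by rewrite normcM normcR ger0_norm//; lra.
pose g (r : R) := G (r%:C * v).
(* Then [r0 * normc v] exceeds [2 t], so the bound [2 / (r0 |v|)] on [G] gives [t |G| < 1] and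
   [F r0 > 0]. *)
pose r0 := 1 + 2 * t / normc v.
have tv : 0 < 2 * t / normc v by rewrite divr_gt0 ?mulr_gt0.
have r01 : 1 <= r0 by rewrite /r0; lra.
have cg (r : R) : 1 <= r -> (g : R -> R[i]^o) @ within `[1, r0] (nbhs r) --> (g r : R[i]^o).
  move=> r1; apply/cvg_normcP => e e0.
  rewrite /= /within /=; apply/nbhs_ballP; exists (e * normc v / 2).
    by rewrite /= divr_gt0// mulr_gt0.
  move=> s rs sI; have {}rs : `|r - s| < e * normc v / 2 := rs.
  have /andP[s1 _] : 1 <= s <= r0 by move: sI; rewrite in_itv.
  suff : normc (g s - g r) < e by rewrite normc_distrC.
  apply: (le_lt_trans (normc_cauchy_transformB mRp m1 (@subset_refl _ _)
    (apart_r r r1) (apart_r s s1))).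
  rewrite -mulrBl -rmorphB normcM normcR distrC.
  apply: (@le_lt_trans _ _ (2 * (`|r - s| / normc v))); last first.
    by rewrite mulrA ltr_pdivrMr// mulrC -ltr_pdivlMr.
  rewrite ler_pM2l// ler_pdivrMr ?mulr_gt0//; try lra.
  rewrite (_ : _ / _ * _ = `|r - s| * normc v * (s * r)); last by field; rewrite gt_eqF.
  rewrite ler_peMr ?mulr_ge0 ?normc_ge0//.
  by rewrite -[leLHS]mulr1 ler_pM.
pose F (r : R) := Fdisc (r%:C * v).
have cF : {within `[1, r0], continuous F}.
  apply/subspace_continuousP => r; rewrite /= in_itv/= => /andP[r1 _].
  have cn (h : R -> R[i]) : (h : R -> R[i]^o) @ within `[1, r0] (nbhs r) --> (h r : R[i]^o) ->
      (fun s => normc (h s) ^+ 2) @ within `[1, r0] (nbhs r) --> normc (h r) ^+ 2.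
    move=> ch.
    have hr : (fun x => re (h x)) @ within `[1, r0] (nbhs r) --> re (h r) by exact: cvg_re.
    have hi : (fun x => im (h x)) @ within `[1, r0] (nbhs r) --> im (h r) by exact: cvg_im.
    have E z : normc z ^+ 2 = re z * re z + im z * im z by rewrite sqr_normcE !expr2.
    rewrite (_ : (fun s => _) = fun s => re (h s) * re (h s) + im (h s) * im (h s)).
      by rewrite E; apply: cvgD; apply: cvgM.
    by apply/funext => s; exact: E.
  rewrite /F /Fdisc; apply: cvgD.
    apply: cvgM; first exact: cvg_cst.
    apply: (cn (fun s => 1 - t%:C * g s)).
    apply: cvgcB; first exact: cvg_cst.
    by apply: cvgcM; [exact: cvg_cst|exact: cg].
  apply: cvgM; first exact: cvg_cst.
  apply: cvgB; first exact: cvg_cst.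
  apply: cvgM; first exact: cvg_cst.
  by apply: (cn g); exact: cg.
have n2 (r : R) : 1 <= r -> 0 < normc (1 - t%:C * G (r%:C * v)) ^+ 2.
  by move=> r1; rewrite exprn_gt0// normc_gt0; have [] := q_neq0 (rv0 r r1).
have F1 : F 1 <= 0.
  move: dle0; rewrite re_disc// pmulr_lle0; first by rewrite /F mul1r.
  by rewrite invr_gt0; have := n2 1 (lexx _); rewrite mul1r.
have F0 : 0 < F r0.
  have X := normc_cauchy_transform mRp m1 (@subset_refl _ _) (apart_r r0 r01).
  have tX : t * normc (G (r0%:C * v)) < 1.
    apply: (@le_lt_trans _ _ (t * (2 * (r0 * normc v)^-1))); first by rewrite ler_wpM2l.
    rewrite mulrA ltr_pdivrMr; last by rewrite mulr_gt0//; lra.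
    rewrite mul1r /r0 mulrDl mul1r divfK ?gt_eqF//; lra.
  rewrite /F /Fdisc ltr_wpDl ?mulr_ge0// ?exprn_ge0 ?normc_ge0//.
  rewrite mulr_gt0// subr_gt0 -exprMn expr_lt1// mulr_ge0 ?normc_ge0//.
have sign (x y : R) : x <= 0 -> 0 < y -> Num.min x y <= 0 <= Num.max x y.
  by move=> x0 y0; rewrite ge_min le_max x0 (ltW y0) orbT.
have [] := @IVT R F 1 r0 0 r01 cF; first exact: sign.
move=> c; rewrite in_itv/= => /andP[c1 _] Fc.
have := re_disc_neq0 tp (rv0 c c1); rewrite re_disc ?rv0//.
by rewrite -/(F c) Fc mul0r eqxx.
Qed.

(** The witness is [w = G v] with [v = 1 / chi z]: since [1 + z = v w], the factor [chi z] cancels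
    [v] in the S-transform. *)
Lemma S_domain_parametrization z : S_domain (m t) z ->
  exists w : R[i], [/\ z != 0, 1 - t%:C * w != 0,
    z * (1 - t%:C * w) ^+ 2 = w * (b%:C + (lambda * t)%:C * (1 - t%:C * w)),
    S_transform (m t) z = w / z &
    0 < t -> 0 < re ((lambda * t)%:C + b%:C * ((1 + t%:C * w) / (1 - t%:C * w)))].
Proof.
move=> Sz; have [ul Pu] : left_half_plane (chi (m t) z) /\ Psi (m t) (chi (m t) z) = z.
  apply: (@xgetPex _ 0 (fun u => left_half_plane u /\ Psi (m t) u = z)).
  by case: Sz => u ? ?; exists u.
set u := chi _ _ in ul Pu; move/left_half_planeP : ul => u0.
have un0 := re_lt0_neq0 u0.
have v0 : re u^-1 < 0.
  by rewrite reV pmulr_llt0// invr_gt0 exprn_gt0// normc_gt0.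
have [w0 Ew] := GE v0; have [q1 q0] := q_neq0 v0.
have zE : z = u^-1 * G u^-1 - 1 by rewrite -Pu (PsiE m1).
have rel : z * (1 - t%:C * G u^-1) ^+ 2 =
    G u^-1 * (b%:C + (lambda * t)%:C * (1 - t%:C * G u^-1)).
  have -> : z = explicit_inverse lambda b t (G u^-1) * G u^-1 - 1 by rewrite Ew.
  move: (G u^-1) w0 q0 => w w0 q0.
  by rewrite /explicit_inverse; field; rewrite w0 q0.
(* Otherwise [b + lambda t (1 - t w) = 0], whereas its real part is at least [b]. *)
have z0 : z != 0.
  apply/eqP => z0; move: rel; rewrite z0 mul0r => /esym/eqP.
  rewrite mulf_eq0 (negbTE w0)/= => /eqP /(congr1 (@complex.Re R)).
  rewrite reD reM [re _%:C]/= [re (lambda * t)%:C]/= [im (lambda * t)%:C]/= mul0r subr0 => E.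
  have : 0 <= lambda * t * re (1 - t%:C * G u^-1) by rewrite !mulr_ge0//; lra.
  by move: E; rewrite /= => E; have := b_gt0; lra.
exists (G u^-1); split => //.
- have E1 : 1 + z = u^-1 * G u^-1 by rewrite zE addrC subrK.
  by rewrite /S_transform -/u E1; field; rewrite un0 z0.
- by move=> tp; exact: re_disc_gt0.
Qed.

End S_transform_formula.

(** * Algebra of the S-formula and its limit as [t] decreases to [0] *)

Section S_formula_facts.
Variables (R : realType) (lambda b : R).
Hypotheses (lambda_ge0 : 0 <= lambda) (b_gt0 : 0 < b).
Implicit Types (z w : R[i]) (t : R).

Let realc_neq0 (a : R) : a != 0 -> a%:C != 0.
Proof. by move=> a0; rewrite -(rmorph0 (real_complex R)) (inj_eq (@complexI R)). Qed.

Let drift_gt0 t : 0 <= t -> 0 < lambda * t + b.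
Proof. by move=> t0; rewrite ltr_wpDl// mulr_ge0. Qed.

(** The quantity under the root in [S_formula], with [b / t] cleared so that it stays regular at
    [t = 0]. *)
Let radicand t z : R[i] := 1 + (4 * b * t / (lambda * t + b) ^+ 2)%:C * z.

Lemma S_formula_sqrtc t z : 0 < t -> z != 0 -> z != - lambda%:C ->
  S_formula lambda b t z =
  (2 * t%:C * z + (lambda * t + b)%:C - (lambda * t + b)%:C * sqrtc (radicand t z))
  / (2 * t%:C ^+ 2 * z * (lambda%:C + z)).
Proof.
move=> t0 z0 zl; have tn0 : t != 0 by rewrite gt_eqF.
have P0 : lambda * t + b != 0 by rewrite gt_eqF// drift_gt0// ltW.
have -> : radicand t z = 1 + (4 * (b / t) / (lambda + b / t) ^+ 2)%:C * z.
  congr (1 + _%:C * z).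
  have E : lambda + b / t = (lambda * t + b) / t by field.
  by rewrite E; field; rewrite P0 tn0.
rewrite /S_formula; set sq := sqrtc _.
have zl0 : lambda%:C + z != 0 by rewrite addrC addr_eq0.
have E : (lambda + b / t)%:C = (lambda * t + b)%:C / t%:C.
  by rewrite -fmorphV -rmorphM; congr _%:C; field.
rewrite E rmorphD rmorphM; field.
by rewrite zl0 z0 realc_neq0.
Qed.

(** With [P = lambda t + b], the relation gives [D^2 = P^2 + 4 b t z]; as [re D > 0], [P] times the
    principal root is [D], and the numerator [2 t z + P - D] equals [2 t^2 (lambda + z) w]. *)
Lemma S_formula_eq t z w : 0 < t -> z != 0 -> z != - lambda%:C ->
  1 - t%:C * w != 0 ->
  z * (1 - t%:C * w) ^+ 2 = w * (b%:C + (lambda * t)%:C * (1 - t%:C * w)) ->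
  0 < re ((lambda * t)%:C + b%:C * ((1 + t%:C * w) / (1 - t%:C * w))) ->
  S_formula lambda b t z = w / z.
Proof.
move=> t0 z0 zl q0 rel D0; set D := (_ + _) in D0.
pose P := lambda * t + b; have Pp : 0 < P by rewrite drift_gt0// ltW.
have PC0 : P%:C != 0 by rewrite realc_neq0// gt_eqF.
have tC0 : t%:C != 0 by rewrite realc_neq0// gt_eqF.
have zl0 : lambda%:C + z != 0 by rewrite addrC addr_eq0.
have zE : z = w * (b%:C + (lambda * t)%:C * (1 - t%:C * w)) / (1 - t%:C * w) ^+ 2.
  by rewrite -rel mulfK// expf_neq0.
have D2 : D ^+ 2 = P%:C ^+ 2 + 4 * b%:C * t%:C * z.
  by rewrite zE /D /P; field.
have key : 2 * t%:C * z + P%:C - D = 2 * t%:C ^+ 2 * (lambda%:C + z) * w.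
  by rewrite zE /D /P; field.
have yE : radicand t z = (P^-1%:C * D) ^+ 2.
  rewrite exprMn D2 /radicand -/P !(rmorphM, fmorphV, rmorphXn) /=.
  by rewrite rmorph_nat; field.
rewrite S_formula_sqrtc// yE sqrtc_sqr; last first.
  by rewrite re_realM mulr_gt0// invr_gt0.
rewrite -/P mulrA -rmorphM mulfV ?gt_eqF// rmorph1 mul1r key; field.
by rewrite zl0 z0 tC0.
Qed.

(** Numerator and denominator both vanish to second order at [0]. Multiplying by the conjugate
    expression [N] turns the formula into [2 / N], and [N] tends to [2 b]. *)
Lemma S_formula_limit z : z != 0 -> z != - lambda%:C ->
  (fun s : R => S_formula lambda b s z : R[i]^o) @ 0^'+ --> ((b^-1)%:C : R[i]^o).
Proof.
move=> z0 zl.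
have zl0 : lambda%:C + z != 0 by rewrite addrC addr_eq0.
have bC0 : b%:C != 0 by rewrite realc_neq0// gt_eqF.
have cid : (fun s : R => s) @ 0^'+ --> (0 : R) by exact: cvg_at_right_filter.
have cP : (fun s : R => lambda * s + b) @ 0^'+ --> b.
  rewrite -[X in _ --> X]add0r -[X in _ --> X + _](mulr0 lambda).
  by apply: cvgD; [apply: cvgM => //; exact: cvg_cst|exact: cvg_cst].
have cPC : ((fun s => (lambda * s + b)%:C) : R -> R[i]^o) @ 0^'+ --> (b%:C : R[i]^o).
  exact: cvg_realc.
have csq : ((fun s => sqrtc (radicand s z)) : R -> R[i]^o) @ 0^'+ --> (1 : R[i]^o).
  apply/cvg_normcP => e e0; have nz : 0 < normc z by rewrite normc_gt0.
  (* Since [lambda s + b >= b], the radicand differs from [1] by at most [4 s |z| / b]. *)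
  have e1 : 0 < e * b / (4 * normc z) by rewrite !divr_gt0 ?mulr_gt0.
  apply: filterS2 (nbhs_right_gt 0) (nbhs_right_lt e1) => s s0 se.
  apply: (le_lt_trans (normc_sqrtc_sub1 _)).
  have Pb : b <= lambda * s + b by rewrite lerDr mulr_ge0// ltW.
  have Pp : 0 < lambda * s + b by rewrite drift_gt0// ltW.
  rewrite /radicand opprD addrA subrr sub0r normcN normcM normcR ger0_norm; last first.
    by rewrite divr_ge0 ?sqr_ge0// !mulr_ge0// ltW.
  apply: (@le_lt_trans _ _ (4 * s / b * normc z)).
    rewrite ler_pM2r// ler_pdivrMr ?exprn_gt0//.
    rewrite [X in X <= _](_ : _ = 4 * s / b * b ^+ 2); last by field; rewrite gt_eqF.
    rewrite ler_pM2l ?divr_gt0 ?mulr_gt0//.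
    by rewrite lerXn2r ?nnegrE// ltW.
  move: se; rewrite ltr_pdivlMr ?mulr_gt0// => se.
  rewrite [X in X < _](_ : _ = s * (4 * normc z) / b); last by ring.
  by rewrite ltr_pdivrMr.
pose N (s : R) : R[i] := 2 * s%:C * z + (lambda * s + b)%:C +
   (lambda * s + b)%:C * sqrtc (radicand s z).
have cN : (N : R -> R[i]^o) @ 0^'+ --> (2 * b%:C : R[i]^o).
  have cs : ((fun s => s%:C) : R -> R[i]^o) @ 0^'+ --> (0%:C : R[i]^o) by exact: cvg_realc.
  have c2 : ((fun s => 2 * s%:C) : R -> R[i]^o) @ 0^'+ --> (2 * 0%:C : R[i]^o).
    by apply: (@cvgcM _ _ _ _ (fun=> 2) _ _ _ _ cs); exact: cvg_cst.
  have c2z : ((fun s => 2 * s%:C * z) : R -> R[i]^o) @ 0^'+ --> (2 * 0%:C * z : R[i]^o).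
    by apply: (@cvgcM _ _ _ _ (fun s => 2 * s%:C) (fun=> z) _ _ c2); exact: cvg_cst.
  have -> : 2 * b%:C = (2 * 0%:C * z + b%:C) + b%:C * 1.
    by rewrite rmorph0; ring.
  exact: (cvgcD (cvgcD c2z cPC) (cvgcM cPC csq)).
have N0 : 2 * b%:C != 0 :> R[i] by rewrite mulf_neq0// pnatr_eq0.
have -> : (b^-1)%:C = 2 * (2 * b%:C)^-1 :> R[i].
  by rewrite fmorphV; field.
have cV : ((fun s => 2 * (N s)^-1) : R -> R[i]^o) @ 0^'+ --> (2 * (2 * b%:C)^-1 : R[i]^o).
  apply: cvgcM; first exact: cvg_cst.
  exact: (@cvgV R[i] _ _ _ N (2 * b%:C) N0 cN).
apply: cvg_trans cV; apply: near_eq_cvg.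
have n0 : 0 < normc (2 * b%:C) by rewrite normc_gt0.
have /cvg_normcP/(_ _ n0) HN := cN.
apply: filterS2 HN (nbhs_right_gt 0) => s sN s0.
have Ns0 : N s != 0.
  by apply/eqP => E; move: sN; rewrite E subr0 ltxx.
have sC0 : s%:C != 0 by rewrite realc_neq0// gt_eqF.
rewrite S_formula_sqrtc//; set P := (lambda * s + b)%:C; set q := sqrtc _.
apply: (mulIf Ns0); rewrite mulfVK//.
have q2 : P ^+ 2 * q ^+ 2 = P ^+ 2 + 4 * b%:C * s%:C * z.
  have P0 : P != 0 by rewrite realc_neq0// gt_eqF// drift_gt0// ltW.
  rewrite sqr_sqrtc /radicand !(rmorphM, fmorphV, rmorphXn) /= -/P.
  by rewrite rmorph_nat; clearbody P; field.
rewrite mulrAC [X in X / _](_ : _ = 2 * (2 * s%:C ^+ 2 * z * (lambda%:C + z))); last first.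
  rewrite /N -/P -/q.
  have -> : (2 * s%:C * z + P - P * q) * (2 * s%:C * z + P + P * q) =
    (2 * s%:C * z + P) ^+ 2 - P ^+ 2 * q ^+ 2 by ring.
  by rewrite q2 /P rmorphD rmorphM; ring.
by rewrite mulfK// !mulf_neq0// ?expf_neq0// pnatr_eq0.
Qed.

End S_formula_facts.

Unset Implicit Arguments.

(** The point [z = - lambda] is set apart because the S-formula carries the factor
    [1 / (lambda + z)]. The bound on the mass at [0] is the condition under which the S-transform is
    defined. *)
Theorem proposition1p8 (R : realType) (lambda b : R)
    (m : R -> probability (measurableTypeR R) R)
    (lambda_ge0 : 0 <= lambda) (b_gt0 : 0 < b)
    (m_process : is_m_process lambda m)
    (m_init : forall A : set (measurableTypeR R), measurable A ->
       m 0 A = \d_b A)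
    (t : R) (t_ge0 : 0 <= t) :
  (\forall z \near (0 : R[i]^o)^',
     R_transform (m t) z = R_formula lambda b t z) /\
  (m t [set 0%R : R] < 1)%E /\
  (0 < t -> forall z : R[i], S_domain (m t) z -> z != - lambda%:C ->
     S_transform (m t) z = S_formula lambda b t z) /\
  (t = 0 -> forall z : R[i], S_domain (m t) z ->
     S_transform (m t) z = (b^-1)%:C /\
     (z != - lambda%:C ->
      (fun s : R => S_formula lambda b s z : R[i]^o) @ 0^'+
        --> (S_transform (m t) z : R[i]^o))).
Proof.
split; first exact: (R_transformE lambda_ge0 b_gt0 m_process m_init t_ge0).
split; first exact: (mass0_lt1 lambda_ge0 b_gt0 m_process m_init t_ge0).
split=> [t0 z Sz zl|tE z Sz];
    have [w [z0 q0 rel -> D0]] := S_domain_parametrization lambda_ge0 b_gt0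
      m_process m_init t_ge0 Sz.
  by rewrite (S_formula_eq lambda_ge0 b_gt0 t0 z0 zl q0 rel (D0 t0)).
(* At [t = 0] the relation between [z] and [w] degenerates to a linear one. *)
have zE : z = w * b%:C.
  by move: rel; rewrite tE mulr0 !mul0r subr0 expr1n !mulr1 addr0.
have -> : w / z = (b^-1)%:C.
  have [w0 b0] : w != 0 /\ b%:C != 0.
    by move: z0; rewrite zE mulf_eq0 negb_or => /andP.
  by rewrite zE fmorphV invfM mulrA divff// mul1r.
by split=> // zl; exact: (S_formula_limit lambda_ge0 b_gt0 z0 zl).
Qed.
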